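(* Let $\mathfrak{g}$ be a strongly unimodular $2n$-dimensional almost nilpotent real Lie algebra with nilradical $\mathfrak{n}$ satisfying $\dim\mathfrak{n}^1=1$, where $\mathfrak{n}^1=[\mathfrak{n},\mathfrak{n}]$. Then $\mathfrak{g}$ admits an SKT structure $(J,g)$ satisfying $J\mathfrak{n}^1=\mathfrak{n}^{\perp_g}$ if and only if it is isomorphic to the Lie algebra $\mathbb{R}\langle f_1,\dots,f_{2n}\rangle$ with structure equations $$df^1=f^2\wedge f^3,\quad df^{2l}=b_l f^{2l+1}\wedge f^{2n},\quad df^{2l+1}=-b_lf^{2l}\wedge f^{2n},\ l=1,\dots,n-1,\quad df^{2n}=0,$$ for some (not all vanishing) $b_l\in\mathbb{R}$, $l=1,\dots,n-1$. In particular $\mathfrak{g}$ is of type I, namely the eigenvalues of $\mathrm{ad}_X$ are purely imaginary for all $X\in\mathfrak{g}$. An example of an SKT structure $(J,g)$ satisfying $J\mathfrak{n}^1=\mathfrak{n}^{\perp_g}$ on such a Lie algebra is given by $Jf_1=f_{2n}$, $Jf_{2l}=f_{2l+1}$ for $l=1,\dots,n-1$, $g=\sum_{l=1}^{2n}(f^l)^2$. In real dimension six, $\mathfrak{g}$ is isomorphic to one among: - $\mathfrak{h}_3\oplus\mathfrak{s}_{3.3}^0=(f^{23},0,0,f^{56},-f^{46},0)$, - $\mathfrak{s}_{4.7}\oplus\mathbb{R}^2=(f^{23},f^{36},-f^{26},0,0,0)$, - $\mathfrak{s}_{6.52}^{0,b}=(f^{23},f^{36},-f^{26},bf^{56},-bf^{46},0)$,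 $b>0$.
   Context: The nilradical $\mathfrak{n}$ of a solvable Lie algebra $\mathfrak{g}$ is its maximal nilpotent ideal; $\mathfrak{g}$ is almost nilpotent if it is solvable and $\mathfrak{n}$ has codimension one. With $\mathfrak{n}^0=\mathfrak{n}$, $\mathfrak{n}^{l}=[\mathfrak{n},\mathfrak{n}^{l-1}]$, a solvable $\mathfrak{g}$ is strongly unimodular if $\operatorname{tr}(\mathrm{ad}_X|_{\mathfrak{n}^l/\mathfrak{n}^{l+1}})=0$ for all $X\in\mathfrak{g}$, $l\in\mathbb{N}$. A Hermitian structure $(J,g)$ on $\mathfrak{g}$ is an integrable complex structure $J$ (vanishing Nijenhuis tensor) together with a positive definite $J$-orthogonal inner product $g$; $\omega=g(J\cdot,\cdot)$. It is SKT if $dd^c\omega=0$, with $d$ the Chevalley–Eilenberg differential and $d^c=i(\overline\partial-\partial)$. $\mathfrak{n}^{\perp_g}$ is the $g$-orthogonal complement of $\mathfrak{n}$ in $\mathfrak{g}$. $(\phi_1,\dots,\phi_6)$ denotes the Lie algebra with basis $\{f_k\}$ whose dual basis satisfies $df^k=\phi_k$, where $f^{kl}=f^k\wedge f^l$ and $d\alpha(X,Y)=-\alpha([X,Y])$. *)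

(* Defs.v *)
From HB Require Import structures.
From mathcomp Require Import all_boot all_order all_algebra.
From mathcomp Require Import reals.
From mathcomp Require Import complex.

Set Implicit Arguments.
Unset Strict Implicit.
Unset Printing Implicit Defensive.

Import Order.TTheory GRing.Theory Num.Theory.
Local Open Scope ring_scope.

(** * Lie algebras

  A Lie algebra is a finite-dimensional vector space [V] together with a bracket
  [br : V -> V -> V] satisfying [lie_bracket br]. *)

Record lie_bracket (R : fieldType) (V : vectType R) (br : V -> V -> V) : Prop :=
  LieBracket {
    lie_linear_l : forall y, linear (br^~ y);
    lie_linear_r : forall x, linear (br x);
    lie_alternating : forall x, br x x = 0;
    lie_jacobi : forall x y z,
      br x (br y z) + br y (br z x) + br z (br x y) = 0 }.

Definition lie_isomorphic (R : fieldType) (V W : vectType R)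
    (brV : V -> V -> V) (brW : W -> W -> W) : Prop :=
  exists2 f : {linear V -> W},
    bijective f & forall x y, f (brV x y) = brW (f x) (f y).

(** [[U, W]]: the span of all brackets (those of basis vectors suffice). *)
Definition lie_prod (R : fieldType) (V : vectType R) (br : V -> V -> V)
    (U W : {vspace V}) : {vspace V} :=
  <<[seq br u w | u <- vbasis U, w <- vbasis W]>>%VS.

Fixpoint lower_central (R : fieldType) (V : vectType R) (br : V -> V -> V)
    (U : {vspace V}) (l : nat) : {vspace V} :=
  if l is l'.+1 then lie_prod br U (lower_central br U l') else U.

Fixpoint derived_series (R : fieldType) (V : vectType R) (br : V -> V -> V)
    (U : {vspace V}) (l : nat) : {vspace V} :=
  if l is l'.+1 then
    lie_prod br (derived_series br U l') (derived_series br U l')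
  else U.

Definition lie_nilpotent (R : fieldType) (V : vectType R) (br : V -> V -> V)
    (U : {vspace V}) : Prop := exists l, lower_central br U l = 0%VS.

Definition lie_solvable (R : fieldType) (V : vectType R) (br : V -> V -> V)
    (U : {vspace V}) : Prop := exists l, derived_series br U l = 0%VS.

Definition lie_ideal (R : fieldType) (V : vectType R) (br : V -> V -> V)
    (U : {vspace V}) : Prop := forall x u, u \in U -> br x u \in U.

Definition is_nilradical (R : fieldType) (V : vectType R) (br : V -> V -> V)
    (N : {vspace V}) : Prop :=
  [/\ lie_ideal br N, lie_nilpotent br N
    & forall M, lie_ideal br M -> lie_nilpotent br M -> (M <= N)%VS].

(** [N] stands for the nilradical. *)
Definition almost_nilpotent (R : fieldType) (V : vectType R) (br : V -> V -> V)
    (N : {vspace V}) : Prop :=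
  lie_solvable br fullv /\ (\dim N).+1 = \dim {:V}.

(** Trace of the endomorphism induced by [f] on [U / W], for [W <= U] and [f]
  preserving both: the quotient is identified with the complement [U :\: W] of
  [W] in [U], and the class of [v] with the projection [addv_pi1 U W v] of [v]
  onto that complement along [W]. *)
Definition quotient_trace (R : fieldType) (V : vectType R) (f : V -> V)
    (U W : {vspace V}) : R :=
  let B := vbasis (U :\: W) in
  \tr (\matrix_(i, j) coord B j (addv_pi1 U W (f B`_i))).

Definition strongly_unimodular (R : fieldType) (V : vectType R)
    (br : V -> V -> V) (N : {vspace V}) : Prop :=
  forall (x : V) (l : nat),
    quotient_trace (br x) (lower_central br N l) (lower_central br N l.+1) = 0.

(** The eigenvalues are those of [ad_x] on the complexification. *)
Definition type_I (R : realType) (V : vectType R) (br : V -> V -> V) : Prop :=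
  forall (x : V) (z : R[i]),
    eigenvalue
      (map_mx (real_complex R)
        (passmx.mxof (vbasis {:V}) (vbasis {:V}) (linfun (br x)))) z ->
    complex.Re z = 0.

(** * Complex-valued forms on a real Lie algebra

  Elements of [Lambda^k g^* (x) C] are represented by their values on [k]-tuples
  of vectors of [g]. *)

Definition form (R : realType) (V : vectType R) (k : nat) : Type :=
  {ffun 'I_k -> V} -> R[i].

(** Chevalley-Eilenberg differential (trivial coefficients):
    [d alpha (x_0, ..., x_{k+1}) = \sum_(i < j) (-1)^(i + j)
       alpha ([x_i, x_j], x_0, .., ^x_i, .., ^x_j, .., x_{k+1})].
  The index [i] ranges over ['I_k.+1] so that, for [i < j], [lift j i] has value
  [i] and [m |-> lift j (lift i m)] enumerates the indices other than [i, j]. *)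
Definition ce_diff (R : realType) (V : vectType R) (br : V -> V -> V) (k : nat)
    (alpha : form V k.+1) : form V k.+2 := fun x =>
  \sum_(j < k.+2) \sum_(i < k.+1 | (i < j)%N)
    (-1) ^+ (i + j) *
    alpha [ffun m : 'I_k.+1 =>
             if unlift ord0 m is Some m' then x (lift j (lift i m'))
             else br (x (lift j i)) (x j)].

(** Component of type [(p, k - p)] of a [k]-form. On the complexification let
  [P = (1 - i J) / 2] and [P' = (1 + i J) / 2] be the projections onto the
  [i]- and [-i]-eigenspaces of [J]. The component is the sum, over the sets [S]
  of [p] slots, of [alpha] precomposed with [P] in the slots of [S] and with [P']
  in the others; [T] is the set of slots where the term in [J] is selected when
  expanding by multilinearity. *)
Definition type_part (R : realType) (V : vectType R) (J : 'End(V)) (k : nat)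
    (p : nat) (alpha : form V k) : form V k := fun x =>
  \sum_(S : {set 'I_k} | #|S| == p)
    2%:R ^- k *
    \sum_(T : {set 'I_k})
      (- 'i) ^+ #|T :&: S| * 'i ^+ #|T :\: S| *
      alpha [ffun m => if m \in T then J (x m) else x m].

Definition del (R : realType) (V : vectType R) (br : V -> V -> V) (J : 'End(V))
    (k : nat) (alpha : form V k.+1) : form V k.+2 := fun x =>
  \sum_(p < k.+2) type_part J p.+1 (ce_diff br (type_part J p alpha)) x.

Definition delbar (R : realType) (V : vectType R) (br : V -> V -> V)
    (J : 'End(V)) (k : nat) (alpha : form V k.+1) : form V k.+2 := fun x =>
  \sum_(p < k.+2) type_part J p (ce_diff br (type_part J p alpha)) x.

Definition dc (R : realType) (V : vectType R) (br : V -> V -> V) (J : 'End(V))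
    (k : nat) (alpha : form V k.+1) : form V k.+2 := fun x =>
  'i * (delbar br J alpha x - del br J alpha x).

(** * Hermitian and SKT structures *)

Definition complex_structure (R : realType) (V : vectType R)
    (br : V -> V -> V) (J : 'End(V)) : Prop :=
  (forall x, J (J x) = - x) /\
  (forall x y, br (J x) (J y) - J (br (J x) y) - J (br x (J y)) - br x y = 0).

Record inner_product (R : realType) (V : vectType R) (g : V -> V -> R) : Prop :=
  InnerProduct {
    ip_linear_l : forall y, scalar (g^~ y);
    ip_sym : forall x y, g x y = g y x;
    ip_pos : forall x, x != 0 -> 0 < g x x }.

Definition hermitian_structure (R : realType) (V : vectType R)
    (br : V -> V -> V) (J : 'End(V)) (g : V -> V -> R) : Prop :=
  [/\ complex_structure br J, inner_product g
    & forall x y, g (J x) (J y) = g x y].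

Definition fundamental_form (R : realType) (V : vectType R) (J : 'End(V))
    (g : V -> V -> R) : form V 2 := fun x =>
  real_complex R (g (J (x ord0)) (x ord_max)).

Definition SKT (R : realType) (V : vectType R) (br : V -> V -> V)
    (J : 'End(V)) (g : V -> V -> R) : Prop :=
  hermitian_structure br J g /\
  forall x, ce_diff br (dc br J (fundamental_form J g)) x = 0.

(** [J n^1 = n^{perp_g}] for [n = N]. *)
Definition J_derived_eq_orth (R : realType) (V : vectType R)
    (br : V -> V -> V) (N : {vspace V}) (J : 'End(V)) (g : V -> V -> R) : Prop :=
  forall v : V,
    v \in (J @: lower_central br N 1)%VS <-> (forall u, u \in N -> g v u = 0).

(** * Lie algebras given by structure equations

  The vectors [f_k] and the covectors [f^k] are numbered from 1. *)

Definition fvec (R : realType) (m : nat) (k : nat) : 'rV[R]_m :=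
  \row_(i < m) (i.+1 == k)%:R.

Definition fcov (R : realType) (m : nat) (k : nat) (x : 'rV[R]_m) : R :=
  \sum_(i < m | i.+1 == k) x 0 i.

Definition fwedge (R : realType) (m : nat) (k l : nat) (x y : 'rV[R]_m) : R :=
  fcov k x * fcov l y - fcov l x * fcov k y.

(** The bracket on [R<f_1, ..., f_m>] for which [d f^k = phi k], where
  [d f^k (x, y) = - f^k [x, y]]. *)
Definition struct_bracket (R : realType) (m : nat)
    (phi : nat -> 'rV[R]_m -> 'rV[R]_m -> R) (x y : 'rV[R]_m) : 'rV[R]_m :=
  \row_(i < m) - phi i.+1 x y.

(** For [k = 2l] or [k = 2l + 1] with [1 <= l <= n - 1], [k./2] is [l]. *)
Definition model_eqs (R : realType) (n : nat) (b : nat -> R) (k : nat)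
    (x y : 'rV[R]_(n.*2)) : R :=
  if k == 1%N then fwedge 2 3 x y
  else if k == n.*2 then 0
  else if odd k then - b k./2 * fwedge k.-1 n.*2 x y
  else b k./2 * fwedge k.+1 n.*2 x y.

Definition model_bracket (R : realType) (n : nat) (b : nat -> R) :
    'rV[R]_(n.*2) -> 'rV[R]_(n.*2) -> 'rV[R]_(n.*2) :=
  struct_bracket (@model_eqs R n b).

(** [b_1, ..., b_{n-1}] are not all zero; other values of [b] are not used. *)
Definition not_all_vanishing (R : realType) (n : nat) (b : nat -> R) : Prop :=
  exists2 l, (1 <= l < n)%N & b l != 0.

Definition std_metric (R : realType) (m : nat) (x y : 'rV[R]_m) : R :=
  \sum_(1 <= l < m.+1) fcov l x * fcov l y.

(** [(phi_1, ..., phi_6)] *)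
Definition bracket6 (R : realType)
    (phi : seq ('rV[R]_6 -> 'rV[R]_6 -> R)) :
    'rV[R]_6 -> 'rV[R]_6 -> 'rV[R]_6 :=
  struct_bracket (fun k => nth (fun _ _ => 0) phi k.-1).

Definition h3_s33 (R : realType) := @bracket6 R
  [:: fun x y => fwedge 2 3 x y;
      fun _ _ => 0;
      fun _ _ => 0;
      fun x y => fwedge 5 6 x y;
      fun x y => - fwedge 4 6 x y;
      fun _ _ => 0].

Definition s47_R2 (R : realType) := @bracket6 R
  [:: fun x y => fwedge 2 3 x y;
      fun x y => fwedge 3 6 x y;
      fun x y => - fwedge 2 6 x y;
      fun _ _ => 0;
      fun _ _ => 0;
      fun _ _ => 0].

Definition s652 (R : realType) (b : R) := @bracket6 R
  [:: fun x y => fwedge 2 3 x y;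
      fun x y => fwedge 3 6 x y;
      fun x y => - fwedge 2 6 x y;
      fun x y => b * fwedge 5 6 x y;
      fun x y => - b * fwedge 4 6 x y;
      fun _ _ => 0].

(* Main.v *)
(* Let e be a unit vector spanning n^1, X := J e (a unit normal of n) and D := ad_X.
   Strong unimodularity makes e central, integrability at (e, y) gives D J = J D, and
     [x, y] = g(x, X) D y - g(y, X) D x + eta(x, y) e
   with eta a J-invariant and D-invariant 2-form killed by e and X. In these terms
   d^c omega = e^* /\ (eta + beta) with beta(y, z) = g(D J y, z) - g(D J z, y), so
   dd^c omega = 0 says that beta is D-invariant and that eta /\ (eta + beta) = 0. The
   first condition gives g(D^2 y, y) + |D y|^2 = 0; taking traces, tr (D + D^T)^2 = 0, so
   D is skew and beta = 0.
   Then eta /\ eta = 0, hence eta has rank two and is carried by a plane <u, J u>,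
   which D preserves. Finally D J is symmetric and commutes with J, so it is diagonal in
   a unitary basis extending u, and this is the model. *)
Require Import Defs.
From HB Require Import structures.
From mathcomp Require Import all_boot all_order all_algebra.
From mathcomp Require Import reals complex.
From mathcomp Require Import boolp zify ring lra.
From mathcomp Require spectral.

Set Implicit Arguments.
Unset Strict Implicit.
Unset Printing Implicit Defensive.

Import Order.TTheory GRing.Theory Num.Theory passmx.
Local Open Scope ring_scope.

(** * Sums over subsets of a small index set *)

(** On a real 3-form without component of type $(3,0)+(0,3)$, the operation $\alpha\mapsto
    i(\alpha^{1,2}-\alpha^{2,1})$ is $-J^*$, and integrability removes exactly that component from
    $d\omega$. Hence [SKT] becomes a real identity, quadratic in the bracket, and complex numbers
    come back only for eigenvalues. Both directions of the equivalence meet in [normal_form], a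
    record that fixes no basis: it follows from an SKT structure, it holds in the model, and it can
    be pulled back along isomorphisms. The nilradical, type I, the SKT condition and the structure
    equations are all deduced from it. Its two nonvanishing conditions have different sources:
    $c\neq0$ because $\mathfrak n$ is not abelian, $D\neq0$ because $\mathfrak g$ is not
    nilpotent. *)

Definition cons_set k (a : bool) (S : {set 'I_k}) : {set 'I_k.+1} :=
  [set i | if unlift ord0 i is Some j then j \in S else a].

Lemma in_cons_set0 k a (S : {set 'I_k}) : (ord0 \in cons_set a S) = a.
Proof. by rewrite inE unlift_none. Qed.

Lemma in_cons_setS k a (S : {set 'I_k}) i :
  (lift ord0 i \in cons_set a S) = (i \in S).
Proof. by rewrite inE liftK. Qed.

Lemma card_cons_set k a (S : {set 'I_k}) : #|cons_set a S| = (a + #|S|)%N.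
Proof.
rewrite -!sum1_card big_mkcond big_ord_recl in_cons_set0 [in RHS]big_mkcond /=.
rewrite (eq_bigr (fun i => if i \in S then 1%N else 0%N)); first by case: a.
by move=> i _; rewrite in_cons_setS.
Qed.

Lemma cons_setI k a b (S T : {set 'I_k}) :
  cons_set a S :&: cons_set b T = cons_set (a && b) (S :&: T).
Proof. by apply/setP => i; rewrite !inE; case: unliftP => [j _|_]; rewrite ?inE. Qed.

Lemma cons_setD k a b (S T : {set 'I_k}) :
  cons_set a S :\: cons_set b T = cons_set (a && ~~ b) (S :\: T).
Proof.
apply/setP => i; rewrite !inE.
by case: unliftP => [j _|_]; rewrite ?inE // andbC.
Qed.

(** Splitting off slot 0 repeatedly turns a sum over subsets of two or three slots into an explicit
    expression that [ring] and [field] can treat. *)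
Lemma sum_cons_set (M : nmodType) k (F : {set 'I_k.+1} -> M) :
  \sum_S F S = \sum_S F (cons_set true S) + \sum_S F (cons_set false S).
Proof.
pose tl (S : {set 'I_k.+1}) : {set 'I_k} := [set j | lift ord0 j \in S].
have tlK a S : tl (cons_set a S) = S.
  by apply/setP => j; rewrite inE in_cons_setS.
have consK (S : {set 'I_k.+1}) : cons_set (ord0 \in S) (tl S) = S.
  by apply/setP => i; rewrite inE; case: unliftP => [j|] ->; rewrite ?inE.
rewrite (bigID (fun S : {set 'I_k.+1} => ord0 \in S)) /=.
congr (_ + _).
- rewrite (reindex_omap (cons_set true) (some \o tl)) => [|S oS] /=.
    by apply: eq_bigl => S; rewrite in_cons_set0 tlK eqxx.
  by rewrite -{2}(consK S) oS.
- rewrite (reindex_omap (cons_set false) (some \o tl)) => [|S oS] /=.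
    by apply: eq_bigl => S; rewrite in_cons_set0 tlK eqxx.
  by rewrite -{2}(consK S) (negbTE oS).
Qed.

Lemma sum_set_ord0 (M : nmodType) (F : {set 'I_0} -> M) : \sum_S F S = F set0.
Proof.
rewrite (big_pred1 set0) // => S.
by apply/esym/eqP/setP => -[].
Qed.

(** * Types of real 2-forms and 3-forms *)

Lemma lift_ord2 : lift ord0 (ord0 : 'I_1) = ord_max :> 'I_2.
Proof. exact/val_inj. Qed.

(** $J^*$ is $1$ on type $(1,1)$ and $-1$ on $(2,0)+(0,2)$, so an invariant form has type $(1,1)$.
    The second hypothesis is what $J^2=-1$ adds to the first. *)
Lemma type_part2E (R : realType) (V : vectType R) (J : 'End(V))
    (f : V -> V -> R) p (x : {ffun 'I_2 -> V}) :
    (forall x y, f (J x) (J y) = f x y) ->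
    (forall x y, f (J x) y = - f x (J y)) ->
  type_part J p (fun x => real_complex R (f (x ord0) (x ord_max))) x =
  (p == 1%N)%:R * real_complex R (f (x ord0) (x ord_max)).
Proof.
move=> fJJ fJ; rewrite /type_part big_mkcond /=.
have I2 : 'i * 'i = -1 :> R[i] by rewrite -expr2 sqrCi.
rewrite !(sum_cons_set, sum_set_ord0) -!lift_ord2.
rewrite !(cons_setI, cons_setD, setI0, setD0, card_cons_set, cards0) /=.
rewrite !ffunE !(in_cons_set0, in_cons_setS) !fJJ !fJ !rmorphN /=.
by case: p => [|[|[|p]]] /=; field: I2.
Qed.

(** Slots are iterated lifts because [big_ord_recl] and the lemmas on [cons_set] produce indices in
    this shape. *)
Local Notation slot0 := ord0 (only parsing).
Local Notation slot1 := (lift ord0 ord0) (only parsing).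
Local Notation slot2 := (lift ord0 (lift ord0 ord0)) (only parsing).
Local Notation slot3 := (lift ord0 (lift ord0 (lift ord0 ord0))) (only parsing).

Lemma type_part0 (R : realType) (V : vectType R) (J : 'End(V)) k p
    (x : {ffun 'I_k -> V}) :
  type_part J p (fun=> 0) x = 0.
Proof.
rewrite /type_part big1 // => S _; rewrite big1 ?mulr0 // => T _.
by rewrite mulr0.
Qed.

(** The coefficient is a product over the slots of $T$: a slot contributes $-i$ if it lies in $S$
    and $i$ otherwise. *)
Lemma sum_subset3 (C : comPzRingType) (i : C) (F : {set 'I_3} -> C) a b c :
  let w (s : bool) := if s then - i else i in
  let S := cons_set a (cons_set b (cons_set c set0)) in
  let G t1 t2 t3 := F (cons_set t1 (cons_set t2 (cons_set t3 set0))) in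
  \sum_T (- i) ^+ #|T :&: S| * i ^+ #|T :\: S| * F T =
    G false false false + w a * G true false false + w b * G false true false +
    w c * G false false true + w a * w b * G true true false +
    w a * w c * G true false true + w b * w c * G false true true +
    w a * w b * w c * G true true true.
Proof.
move=> w S G; rewrite !(sum_cons_set, sum_set_ord0) /G /S.
rewrite !(cons_setI, cons_setD, set0I, set0D, card_cons_set, cards0) /w.
by case: a {S} => /=; case: b => /=; case: c => /=; ring.
Qed.

(** On type $(p,q)$ the two sides of the hypothesis are multiplication by $i(p-q)$ and by $i^{p-q}$.
    These agree for $p-q=\pm1$ and differ for $p-q=\pm3$, so the hypothesis excludes $(3,0)+(0,3)$.
    On the rest, $-J^*$ is $i$ on $(1,2)$ and $-i$ on $(2,1)$. *)
Lemma type_part3_diff (R : realType) (V : vectType R) (J : 'End(V))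
    (a : V -> V -> V -> R) (x : {ffun 'I_3 -> V}) :
    (forall x y z, a (J x) y z + a x (J y) z + a x y (J z) =
       a (J x) (J y) (J z)) ->
  let A := fun y : {ffun 'I_3 -> V} =>
    real_complex R (a (y slot0) (y slot1) (y slot2)) in
  'i * (type_part J 1 A x - type_part J 2 A x) =
  real_complex R (- a (J (x slot0)) (J (x slot1)) (J (x slot2))).
Proof.
move=> aJ A; rewrite /type_part !(big_mkcond (fun S => _ == _)) /=.
have I2 : 'i * 'i = -1 :> R[i] by rewrite -expr2 sqrCi.
pose E (S : {set 'I_3}) := 2%:R ^- 3 * \sum_(T : {set 'I_3})
  (- 'i) ^+ #|T :&: S| * 'i ^+ #|T :\: S| *
  A [ffun m => if m \in T then J (x m) else x m].
rewrite -[X in 'i * (X - _)]/(\sum_(S : {set 'I_3}) if #|S| == 1%N then E S else 0).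
rewrite -[X in 'i * (_ - X)]/(\sum_(S : {set 'I_3}) if #|S| == 2%N then E S else 0).
rewrite !(sum_cons_set, sum_set_ord0) !(card_cons_set, cards0) /= !(add0r, addr0).
rewrite /E !sum_subset3 /A !ffunE !(in_cons_set0, in_cons_setS) rmorphN /= -aJ.
by rewrite !rmorphD /=; field: I2.
Qed.

(** * SKT condition through the torsion of the Bismut connection *)

(** This is $-d\omega(Jx,Jy,Jz)$, expanded with $g(J\cdot,J\cdot)=g$. *)
Definition bismut_torsion (R : realType) (V : vectType R) (br : V -> V -> V)
    (J : 'End(V)) (g : V -> V -> R) (x y z : V) : R :=
  g (br (J x) (J y)) z + g (br (J y) (J z)) x + g (br (J z) (J x)) y.

Lemma ord3_enum :
  (lift (lift ord0 ord0) ord0 = slot0 :> 'I_3) *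
  (lift slot2 ord0 = slot0 :> 'I_3) * (lift slot2 slot1 = slot1 :> 'I_3) *
  (lift slot1 slot1 = slot2 :> 'I_3).
Proof. by split; [split; [split|]|]; apply/val_inj. Qed.

Lemma lie_linear (R : fieldType) (V : vectType R) (br : V -> V -> V) :
  lie_bracket br -> [/\ forall x y z, br (x + y) z = br x z + br y z,
   forall x y z, br x (y + z) = br x y + br x z,
   forall a x y, br (a *: x) y = a *: br x y &
   forall a x y, br x (a *: y) = a *: br x y].
Proof.
move=> L; have l0 x : br 0 x = 0.
  have := lie_linear_l L x 1 0 0; rewrite !scale1r addr0 => /eqP.
  by rewrite -subr_eq0 opprD addrA subrr sub0r oppr_eq0 => /eqP.
have r0 x : br x 0 = 0.
  have := lie_linear_r L x 1 0 0; rewrite !scale1r addr0 => /eqP.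
  by rewrite -subr_eq0 opprD addrA subrr sub0r oppr_eq0 => /eqP.
split=> [x y z|x y z|a x y|a x y].
- by have := lie_linear_l L z 1 x y; rewrite !scale1r.
- by have := lie_linear_r L x 1 y z; rewrite !scale1r.
- by have := lie_linear_l L y a x 0; rewrite l0 !addr0.
- by have := lie_linear_r L x a y 0; rewrite r0 !addr0.
Qed.

Lemma lie_anti (R : fieldType) (V : vectType R) (br : V -> V -> V) :
  lie_bracket br -> forall x y, br x y = - br y x.
Proof.
move=> L x y; have [Dl Dr _ _] := lie_linear L.
apply/eqP; rewrite -addr_eq0; apply/eqP.
have := lie_alternating L (x + y).
by rewrite Dl !Dr !(lie_alternating L) add0r addr0.
Qed.

(** * Rules of calculation for a real inner product *)

Section InnerProduct.
Context (R : realType) (V : vectType R) (g : V -> V -> R).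
Context (ip : inner_product g).

Lemma ipC x y : g x y = g y x. Proof. exact: ip_sym. Qed.

Lemma ip0l x : g 0 x = 0.
Proof.
have := ip_linear_l ip x 1 0 0; rewrite scale1r addr0 mul1r => /eqP.
by rewrite -subr_eq0 opprD addrA subrr sub0r oppr_eq0 => /eqP.
Qed.

Lemma ipDl x y z : g (x + y) z = g x z + g y z.
Proof. by have := ip_linear_l ip z 1 x y; rewrite scale1r mul1r. Qed.

Lemma ipZl a x y : g (a *: x) y = a * g x y.
Proof. by have := ip_linear_l ip y a x 0; rewrite addr0 ip0l addr0. Qed.

Lemma ipNl x y : g (- x) y = - g x y.
Proof. by rewrite -scaleN1r ipZl mulN1r. Qed.

Lemma ipBl x y z : g (x - y) z = g x z - g y z.
Proof. by rewrite ipDl ipNl. Qed.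

Lemma ip0r x : g x 0 = 0. Proof. by rewrite ipC ip0l. Qed.

Lemma ipDr x y z : g x (y + z) = g x y + g x z.
Proof. by rewrite ipC ipDl !(ipC x). Qed.

Lemma ipZr a x y : g x (a *: y) = a * g x y.
Proof. by rewrite ipC ipZl (ipC x). Qed.

Lemma ipNr x y : g x (- y) = - g x y.
Proof. by rewrite ipC ipNl (ipC x). Qed.

Lemma ipBr x y z : g x (y - z) = g x y - g x z.
Proof. by rewrite ipDr ipNr. Qed.

Lemma ip_suml (I : Type) (r : seq I) (P : pred I) (F : I -> V) x :
  g (\sum_(i <- r | P i) F i) x = \sum_(i <- r | P i) g (F i) x.
Proof. by apply: (big_morph (g^~ x)) => [y z|]; rewrite (ipDl, ip0l). Qed.

Lemma ip_eq0 x : (g x x == 0) = (x == 0).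
Proof.
apply/eqP/eqP => [gx0 | ->]; last exact: ip0l.
apply/eqP; apply: contra_eqT gx0 => /(ip_pos ip).
by rewrite lt_neqAle eq_sym => /andP[].
Qed.

Lemma ip_ge0 x : 0 <= g x x.
Proof. by have [->|/(ip_pos ip)/ltW//] := eqVneq x 0; rewrite ip0l. Qed.

Lemma ip_inj x y : (forall z, g x z = g y z) -> x = y.
Proof.
by move=> xy; apply/eqP; rewrite -subr_eq0 -ip_eq0 ipBl xy subrr.
Qed.

Definition ipE := (ipDl, ipDr, ipBl, ipBr, ipNl, ipNr, ipZl, ipZr, ip0l, ip0r).

End InnerProduct.

Lemma ord4_enum :
  (lift slot3 slot2 = slot2 :> 'I_4) * (lift slot3 slot1 = slot1 :> 'I_4) *
  (lift slot2 slot1 = slot1 :> 'I_4) * (lift slot1 slot1 = slot2 :> 'I_4) *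
  (lift slot2 slot2 = slot3 :> 'I_4) * (lift slot1 slot2 = slot3 :> 'I_4).
Proof. by do 5?split; apply/val_inj. Qed.

Lemma lift_slot0 k (i : 'I_k.+1) :
  lift (lift ord0 i) ord0 = ord0 :> 'I_k.+2.
Proof. exact/val_inj. Qed.

Lemma ce_diff_fundamental (R : realType) (V : vectType R) (br : V -> V -> V)
    (J : 'End(V)) (g : V -> V -> R) (x : {ffun 'I_3 -> V}) :
    lie_bracket br -> inner_product g ->
  ce_diff br (fundamental_form J g) x =
  real_complex R (- (g (J (br (x slot0) (x slot1))) (x slot2) +
    g (J (br (x slot1) (x slot2))) (x slot0) +
    g (J (br (x slot2) (x slot0))) (x slot1))).
Proof.
move=> L ip; rewrite /ce_diff /fundamental_form -lift_ord2.
under eq_bigr do rewrite big_mkcond.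
rewrite !(big_ord_recl, big_ord0) /= !ffunE unlift_none !liftK /=.
rewrite !lift_slot0 !ord3_enum.
have JN v : J (- v) = - J v by rewrite linearN.
rewrite (lie_anti L (x slot2) (x slot0)) JN (ipNl ip).
by rewrite !(rmorphN, rmorphD) /=; ring.
Qed.

Lemma ce_diff3E (R : realType) (V : vectType R) (br : V -> V -> V)
    (c : V -> V -> V -> R) (x : {ffun 'I_4 -> V}) :
  ce_diff br (fun y : {ffun 'I_3 -> V} =>
    real_complex R (c (y slot0) (y slot1) (y slot2))) x =
  real_complex R (
    - c (br (x slot0) (x slot1)) (x slot2) (x slot3)
    + c (br (x slot0) (x slot2)) (x slot1) (x slot3)
    - c (br (x slot0) (x slot3)) (x slot1) (x slot2)
    - c (br (x slot1) (x slot2)) (x slot0) (x slot3)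
    + c (br (x slot1) (x slot3)) (x slot0) (x slot2)
    - c (br (x slot2) (x slot3)) (x slot0) (x slot1)).
Proof.
rewrite /ce_diff.
under eq_bigr do rewrite big_mkcond.
rewrite !(big_ord_recl, big_ord0) /= !ffunE unlift_none !liftK /=.
rewrite !lift_slot0 !ord3_enum !ord4_enum.
rewrite !(rmorphN, rmorphD) /=; ring.
Qed.

Lemma dc_fundamental (R : realType) (V : vectType R) (br : V -> V -> V)
    (J : 'End(V)) (g : V -> V -> R) :
    lie_bracket br -> hermitian_structure br J g ->
  dc br J (fundamental_form J g) = fun x =>
    real_complex R (bismut_torsion br J g (x slot0) (x slot1) (x slot2)).
Proof.
move=> L [[JJ N] ip gJ]; apply/funext => x.
(* Since $\omega$ has type $(1,1)$, one term survives in each of [del] and [delbar]: the components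
   $(2,1)$ and $(1,2)$ of $d\omega$. *)
have type_omega p : type_part J p (fundamental_form J g) =
    if p == 1%N then fundamental_form J g else fun=> 0.
  apply/funext => y; rewrite [LHS](@type_part2E _ _ J (fun u v => g (J u) v)).
  - by case: (p == 1%N); rewrite ?mul1r ?mul0r.
  - by move=> u v; rewrite !gJ.
  - by move=> u v; rewrite gJ JJ (ipNl ip).
have d0 : @ce_diff R V br 1 (fun=> 0) = fun=> 0.
  apply/funext => y; rewrite /ce_diff big1 // => i _.
  by rewrite big1 // => j _; rewrite mulr0.
rewrite /dc /delbar /del !big_ord_recl !big_ord0 !type_omega /= !d0 !type_part0.
rewrite !add0r !addr0.
pose a u v w := - (g (J (br u v)) w + g (J (br v w)) u + g (J (br w u)) v).
have -> : ce_diff br (fundamental_form J g) =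
    fun y => real_complex R (a (y slot0) (y slot1) (y slot2)).
  by apply/funext => y; rewrite ce_diff_fundamental.
rewrite type_part3_diff /a /bismut_torsion; first by rewrite !gJ opprK.
move=> u v w.
(* The vanishing Nijenhuis tensor, solved for $[Jp,Jq]$, is what verifies the type condition on
   $d\omega$. *)
have Ng p q r : g (br (J p) (J q)) r =
    g (J (br (J p) q)) r + g (J (br p (J q))) r + g (br p q) r.
  by rewrite -!(ipDl ip); congr g; apply/eqP; rewrite -subr_eq0 !opprD !addrA N.
by rewrite !gJ !Ng; ring.
Qed.

Lemma SKT_bismut (R : realType) (V : vectType R) (br : V -> V -> V)
    (J : 'End(V)) (g : V -> V -> R) :
    lie_bracket br -> hermitian_structure br J g ->
  let c := bismut_torsion br J g in
  SKT br J g <-> forall x y z w,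
    c (br x y) z w - c (br x z) y w + c (br x w) y z +
    c (br y z) x w - c (br y w) x z + c (br z w) x y = 0.
Proof.
move=> L H c; have H2 := dc_fundamental L H; split=> [[_ S] x y z w|S].
  have := S [ffun i : 'I_4 => nth 0 [:: x; y; z; w] i].
  rewrite H2 ce_diff3E !ffunE /= => /(congr1 (@complex.Re R)) /= e.
  by apply/eqP; rewrite -oppr_eq0; apply/eqP; rewrite -[RHS]e -/c; ring.
split=> // x; rewrite H2 ce_diff3E -(rmorph0 (real_complex R)).
apply: congr1; rewrite -[RHS]oppr0.
by rewrite -[in RHS](S (x slot0) (x slot1) (x slot2) (x slot3)) -/c; ring.
Qed.

(** * Unitary eigenbases *)

Lemma linear_hom (R : fieldType) (V W : vectType R) (f : V -> W) :
  linear f -> exists h : 'Hom(V, W), h =1 f.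
Proof.
move=> lf; pose F : {linear V -> W} :=
  HB.pack f (GRing.isLinear.Build R V W _ f lf).
by exists (linfun F) => x; rewrite lfunE.
Qed.

Lemma orth_vspace (R : realType) (V : vectType R) (g : V -> V -> R) (x : V) :
  inner_product g -> exists U : {vspace V}, forall y, (y \in U) = (g y x == 0).
Proof.
move=> ip; have [|h hE] := @linear_hom _ V R^o (g^~ x).
  by move=> a y z; rewrite (ipDl ip) (ipZl ip).
by exists (lker h) => y; rewrite memv_ker hE.
Qed.

(** The vectors are the real and imaginary parts of a complex eigenvector; with them the argument
    stays in $V$ instead of its complexification. *)
Lemma complex_eigenvector (R : realType) (V : vectType R) (f : 'End(V))
    (z : R[i]) :
    eigenvalue (map_mx (real_complex R)
      (mxof (vbasis {:V}) (vbasis {:V}) f)) z ->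
  exists v w, [/\ (v != 0) || (w != 0),
    f v = complex.Re z *: v - complex.Im z *: w &
    f w = complex.Im z *: v + complex.Re z *: w].
Proof.
set e := vbasis {:V}; set M := mxof e e f.
have eb : basis_of {:V} e := vbasisP _.
case/eigenvalueP => x xM x0.
pose p : 'rV[R]_(\dim {:V}) := map_mx (@complex.Re R) x.
pose q : 'rV[R]_(\dim {:V}) := map_mx (@complex.Im R) x.
exists (vecof e p), (vecof e q).
rewrite !(vecof_eq0 eb) !(hom_vecof e eb) -/M.
have xE i : (x *m map_mx (real_complex R) M) 0 i =
    Complex ((p *m M) 0 i) ((q *m M) 0 i).
  rewrite !mxE; transitivity (\sum_j Complex (p 0 j * M j i) (q 0 j * M j i)).
    apply: eq_bigr => j _; rewrite !mxE /=; case: (x 0 j) => a b.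
    by apply/eqP; rewrite eq_complex /=; apply/andP; split; apply/eqP; ring.
  apply: (big_ind3 (fun a b c => a = Complex b c)) => // ? ? ? ? ? ? -> ->.
  by [].
split.
- rewrite -negb_and; apply: contra x0 => /andP[/eqP p0 /eqP q0].
  apply/eqP/rowP => i; move/rowP/(_ i): p0; move/rowP/(_ i): q0.
  by rewrite !mxE; case: (x 0 i) => a b /= -> ->.
- transitivity (vecof e (complex.Re z *: p - complex.Im z *: q)); last first.
    by rewrite linearB !linearZ.
  congr vecof; apply/rowP => i; have := xE i.
  rewrite xM !mxE; case: (z) => a b; case: (x 0 i) => c d.
  by rewrite {1}/GRing.mul /= => -[].
- transitivity (vecof e (complex.Im z *: p + complex.Re z *: q)); last first.
    by rewrite linearD !linearZ.
  congr vecof; apply/rowP => i; have := xE i.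
  rewrite xM !mxE; case: (z) => a b; case: (x 0 i) => c d.
  by rewrite {1}/GRing.mul /= => -[_ <-]; ring.
Qed.

(** An eigenvalue $a+ib$ exists over $\mathbb{C}$. Comparing $g(fv,w)$ with $g(v,fw)$ for the parts
    $v,w$ of an eigenvector gives $b(|v|^2+|w|^2)=0$. *)
Lemma symmetric_eigenvector (R : realType) (V : vectType R) (g : V -> V -> R)
    (f : 'End(V)) :
    inner_product g -> (forall x y, g (f x) y = g x (f y)) ->
    (0 < \dim {:V})%N ->
  exists a v, v != 0 /\ f v = a *: v.
Proof.
move=> ip fS dV.
have [z /complex_eigenvector[v [w [vw fv fw]]]] := spectral.eigenvalue_closed (map_mx
  (real_complex R) (mxof (vbasis {:V}) (vbasis {:V}) f)) dV.
move: fv fw; set a := complex.Re z; set b := complex.Im z => fv fw.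
have b0 : b = 0.
  have := fS v w; rewrite fv fw !(ipE ip) => e.
  have : b * (g v v + g w w) == 0 by apply/eqP; lra.
  rewrite mulf_eq0 => /orP[/eqP//|].
  rewrite paddr_eq0 ?(ip_ge0 ip) // !(ip_eq0 ip).
  by case/andP=> v0 w0; move: vw; rewrite v0 w0.
exists a; case/orP: vw => [v0|w0]; [exists v | exists w]; split=> //.
  by rewrite fv b0 scale0r subr0.
by rewrite fw b0 scale0r add0r.
Qed.

Lemma symmetric_eigenvector_in (R : realType) (V : vectType R)
    (g : V -> V -> R) (f : 'End(V)) (U : {vspace V}) :
    inner_product g -> (forall x y, g (f x) y = g x (f y)) ->
    (forall x, x \in U -> f x \in U) -> U != 0%VS ->
  exists a v, [/\ v \in U, v != 0 & f v = a *: v].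
Proof.
move=> ip fS fU U0.
pose gU (x y : subvs_of U) := g (vsval x) (vsval y).
have ipU : inner_product gU.
  split=> [y a x x'|x y|x x0]; rewrite /gU.
  - by rewrite linearP !(ipE ip).
  - exact: (ipC ip).
  - by apply: (ip_pos ip); apply: contraNneq x0 => x0; apply/eqP/val_inj.
have [|h hE] := @linear_hom _ (subvs_of U) (subvs_of U)
    (fun x => vsproj U (f (vsval x))).
  by move=> a x y; rewrite !linearP.
have hS x y : gU (h x) y = gU x (h y).
  by rewrite /gU !hE !vsprojK ?fU ?subvsP ?fS.
have [|a [v [v0 hv]]] := symmetric_eigenvector ipU hS.
  by rewrite dimvf /= lt0n dimv_eq0.
exists a, (vsval v); split; first exact: subvsP.
  by apply: contra v0 => /eqP v0; apply/eqP/val_inj.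
by rewrite -(vsprojK (fU _ (subvsP v))) -hE hv linearZ.
Qed.

(** As [B] commutes with [J], an eigenvector $u$ yields an eigenplane $\langle u,Ju\rangle$, whose
    orthogonal complement in [U] is again stable under both; the induction is on the dimension. Only
    the vectors $u_i$ are listed, the other half of the basis being $Ju_i$. *)
Lemma unitary_eigenbasis (R : realType) (V : vectType R) (g : V -> V -> R)
    (J B : 'End(V)) (U : {vspace V}) :
    inner_product g -> (forall x, J (J x) = - x) ->
    (forall x y, g (J x) (J y) = g x y) ->
    (forall x y, g (B x) y = g x (B y)) -> (forall x, B (J x) = J (B x)) ->
    (forall x, x \in U -> J x \in U) -> (forall x, x \in U -> B x \in U) ->
  exists m (u : nat -> V) (b : nat -> R),
    [/\ forall i, (i < m)%N -> u i \in U,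
        forall i, (i < m)%N -> B (u i) = b i *: u i,
        forall i j, (i < m)%N -> (j < m)%N -> g (u i) (u j) = (i == j)%:R,
        forall i j, (i < m)%N -> (j < m)%N -> g (u i) (J (u j)) = 0 &
        forall v, v \in U ->
          v = \sum_(i < m) (g v (u i) *: u i + g v (J (u i)) *: J (u i))].
Proof.
move=> ip JJ gJ BS BJ; have [d] := ubnP (\dim U).
elim: d U => // d IHd U; rewrite ltnS => dU JU BU.
have gJl x y : g (J x) y = - g x (J y) by rewrite -gJ JJ (ipE ip).
have gJ0 x : g x (J x) = 0.
  by have := gJl x x; rewrite (ipC ip) => ?; lra.
have [->|U0] := eqVneq U 0%VS.
  exists 0%N, (fun=> 0), (fun=> 0); split=> // v.
  by rewrite memv0 big_ord0 => /eqP.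
have [a [v [vU v0 Bv]]] := symmetric_eigenvector_in ip BS BU U0.
pose u := (Num.sqrt (g v v))^-1 *: v.
have gv0 : Num.sqrt (g v v) != 0 by rewrite gt_eqF // sqrtr_gt0 (ip_pos ip).
have uU : u \in U by rewrite memvZ.
have Bu : B u = a *: u by rewrite /u linearZ /= Bv !scalerA mulrC.
have guu : g u u = 1.
  rewrite /u !(ipE ip) -{3}(sqr_sqrtr (ip_ge0 ip v)) expr2; by field.
clearbody u; have [P PE] := orth_vspace u ip; have [Q QE] := orth_vspace (J u) ip.
pose W := (U :&: P :&: Q)%VS.
have WE x : (x \in W) = [&& x \in U, g x u == 0 & g x (J u) == 0].
  by rewrite !memv_cap PE QE andbA.
have [||| m [w [b [wW Bw ww wJw wE]]]] := IHd W.
- apply: leq_trans dU; rewrite ltn_neqAle dimvS ?andbT; last first.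
    by apply/subvP => x; rewrite WE => /and3P[].
  apply/negP => /eqP dWU.
  have /eqP WU : W == U.
    by rewrite eqEdim dWU leqnn andbT; apply/subvP => x; rewrite WE => /and3P[].
  by move: uU; rewrite -WU WE guu oner_eq0 andbF.
- move=> x; rewrite !WE gJ !gJl => /and3P[xU /eqP -> /eqP ->].
  by rewrite JU // oppr0 eqxx.
- move=> x; rewrite !WE !BS BJ Bu linearZ !(ipE ip) => /and3P[xU /eqP -> /eqP ->].
  by rewrite BU // mulr0 eqxx.
have wu i : (i < m)%N -> [/\ g (w i) u = 0, g (w i) (J u) = 0,
    g u (w i) = 0 & g u (J (w i)) = 0].
  move=> /wW; rewrite WE => /and3P[_ /eqP wu /eqP wJu].
  by split; rewrite ?(ipC ip u) // gJl wJu oppr0.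
exists m.+1, (fun i => if i is i'.+1 then w i' else u),
  (fun i => if i is i'.+1 then b i' else a); split.
- by case=> // i /wW; rewrite WE => /and3P[].
- by case=> // i /Bw.
- move=> [|i] [|j] //.
  + by move=> _ /wu[].
  + by move=> /wu[].
  + by move=> i_m j_m; rewrite ww.
- move=> [|i] [|j] //.
  + by move=> _ /wu[].
  + by move=> /wu[].
  + by move=> i_m j_m; rewrite wJw.
move=> x xU; rewrite big_ord_recl /=.
set y := g x u *: u + _.
have gJuu : g (J u) u = 0 by rewrite gJl gJ0 oppr0.
have xyW : x - y \in W.
  rewrite WE memvB ?memvD ?memvZ ?JU //= /y !(ipE ip) gJ guu gJ0 gJuu.
  by apply/andP; split; apply/eqP; ring.
apply/eqP; rewrite addrC -subr_eq [X in X == _](wE _ xyW); apply/eqP.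
apply: eq_bigr => i _; have [wu0 wJu0 uw0 uJw0] := wu _ (ltn_ord i).
by rewrite /y !(ipE ip) uw0 uJw0 gJ (gJl u) uJw0 uw0 oppr0 !mulr0 !addr0 !subr0.
Qed.

(** * Consequences of the normal form *)

(** [lie_prod] spans brackets of two chosen bases only; arbitrary arguments are reached one at a
    time, through images of spans under $[\cdot,y]$ and $[u,\cdot]$. *)
Lemma memv_lie_prod (R : fieldType) (V : vectType R) (br : V -> V -> V)
    (U W : {vspace V}) (x y : V) :
  lie_bracket br -> x \in U -> y \in W -> br x y \in lie_prod br U W.
Proof.
move=> L xU yW; have [hy hyE] := linear_hom (lie_linear_l L y).
rewrite -hyE; have : hy x \in (hy @: U)%VS by rewrite memv_img.
apply/subvP; rewrite -{1}(span_basis (vbasisP U)) limg_span.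
apply/span_subvP => _ /mapP[u uU ->]; rewrite hyE.
have [hu huE] := linear_hom (lie_linear_r L u).
rewrite -huE; have : hu y \in (hu @: W)%VS by rewrite memv_img.
apply/subvP; rewrite -{1}(span_basis (vbasisP W)) limg_span.
apply/span_subvP => _ /mapP[w wW ->]; rewrite huE.
by apply/memv_span/allpairsP; exists (u, w).
Qed.

Lemma lie_prod_subv (R : fieldType) (V : vectType R) (br : V -> V -> V)
    (U W Z : {vspace V}) :
  (forall x y, x \in U -> y \in W -> br x y \in Z) -> (lie_prod br U W <= Z)%VS.
Proof.
move=> brZ; apply/span_subvP => _ /allpairsP[[x y] /= [xU yW ->]].
by rewrite brZ ?vbasis_mem.
Qed.

Lemma nilradical_unique (R : fieldType) (V : vectType R) (br : V -> V -> V)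
    (M N : {vspace V}) : is_nilradical br M -> is_nilradical br N -> M = N.
Proof.
move=> [iM nM maxM] [iN nN maxN]; apply/eqP.
by rewrite eqEsubv maxM // maxN.
Qed.

(** The Lie axioms are not among the fields: they follow from the formula for the bracket. Here
    [J e] is the unit normal of the nilradical and [D] is its adjoint action. *)
Record normal_form (R : realType) (V : vectType R) (br : V -> V -> V)
    (J : 'End(V)) (g : V -> V -> R) (D : 'End(V)) (e u : V) (b c : R) : Prop :=
  NormalForm {
    nf_ip : inner_product g;
    nf_JJ : forall x, J (J x) = - x;
    nf_gJ : forall x y, g (J x) (J y) = g x y;
    nf_DJ : forall x, D (J x) = J (D x);
    nf_skew : forall x y, g (D x) y = - g x (D y);
    nf_De : D e = 0;
    nf_Du : D u = b *: J u;
    nf_ee : g e e = 1;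
    nf_uu : g u u = 1;
    nf_ue : g u e = 0;
    nf_uJe : g u (J e) = 0;
    nf_c : c != 0;
    nf_D : exists x, D x != 0;
    nf_br : forall x y, br x y = g x (J e) *: D y - g y (J e) *: D x +
      (c * (g x u * g y (J u) - g y u * g x (J u))) *: e }.

(** Components of $Dx$ and $Jx$ along $e,Je,u,Ju$. Once an identity between vectors is paired with a
    test vector, these rules reduce Jacobi, Nijenhuis and SKT to polynomial identities. *)
Lemma nf_eval (R : realType) (V : vectType R) (br : V -> V -> V)
    (J : 'End(V)) (g : V -> V -> R) (D : 'End(V)) (e u : V) (b c : R) :
    normal_form br J g D e u b c ->
  [/\ forall x, g (D x) e = 0 /\ g (D x) (J e) = 0,
      forall x, g (D x) u = - b * g x (J u) /\ g (D x) (J u) = b * g x u,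
      forall x, [/\ g (J x) (J e) = g x e, g (J x) (J u) = g x u &
                   g (J x) u = - g x (J u)],
      g e (J e) = 0 /\ g u (J u) = 0 &
      [/\ g e u = 0, g e (J u) = 0 & D (J e) = 0]].
Proof.
case=> ip JJ gJ DJ Dg De Du ee uu ue uJe _ _ _.
have gJl x y : g (J x) y = - g x (J y) by rewrite -gJ JJ (ipE ip).
have gJ0 x : g x (J x) = 0.
  by have := gJl x x; rewrite (ipC ip) => ?; lra.
have DJe : D (J e) = 0 by rewrite DJ De linear0.
have DJu : D (J u) = - b *: u by rewrite DJ Du linearZ /= JJ scalerN scaleNr.
split=> //.
- by move=> x; rewrite !Dg De DJe !(ipE ip) oppr0.
- by move=> x; rewrite !Dg Du DJu !(ipE ip); split; ring.
- by split=> //; rewrite (ipC ip) // gJl uJe oppr0.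
Qed.

Lemma nf_lie_bracket (R : realType) (V : vectType R) (br : V -> V -> V)
    (J : 'End(V)) (g : V -> V -> R) (D : 'End(V)) (e u : V) (b c : R) :
  normal_form br J g D e u b c -> lie_bracket br.
Proof.
move=> nf; have [gDe gDu gJ_ [eJe uJu] [eu eJu DJe]] := nf_eval nf.
case: nf => ip JJ gJ DJ Dg De Du ee uu ue uJe _ _ brE.
have gDe1 x := (gDe x).1; have gDe2 x := (gDe x).2.
have gDu1 x := (gDu x).1; have gDu2 x := (gDu x).2.
split.
- move=> y a x x'; apply: (ip_inj ip) => z.
  by rewrite !brE linearP !(ipE ip); ring.
- move=> y a x x'; apply: (ip_inj ip) => z.
  by rewrite !brE linearP !(ipE ip); ring.
- by move=> x; apply: (ip_inj ip) => z; rewrite !brE !(ipE ip); ring.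
have brg x y w : g (br x y) w = g x (J e) * g (D y) w - g y (J e) * g (D x) w +
    c * (g x u * g y (J u) - g y u * g x (J u)) * g e w.
  by rewrite brE !(ipE ip).
have Dbr x y : D (br x y) = g x (J e) *: D (D y) - g y (J e) *: D (D x).
  by rewrite brE linearD linearB !linearZ /= De scaler0 addr0.
move=> x y z; apply: (ip_inj ip) => w.
rewrite !(ipDl ip) (ip0l ip) !brg !Dbr !(ipBl ip) !(ipZl ip).
by rewrite !(gDe1, gDe2, gDu1, gDu2, eJe, eu, eJu); ring.
Qed.

Lemma nf_hermitian (R : realType) (V : vectType R) (br : V -> V -> V)
    (J : 'End(V)) (g : V -> V -> R) (D : 'End(V)) (e u : V) (b c : R) :
  normal_form br J g D e u b c -> hermitian_structure br J g.
Proof.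
move=> nf; have [gDe gDu gJ_ [eJe uJu] [eu eJu DJe]] := nf_eval nf.
case: nf => ip JJ gJ DJ Dg De Du ee uu ue uJe _ _ brE.
have gJe x : g (J x) (J e) = g x e by have [] := gJ_ x.
have gJu x : g (J x) (J u) = g x u by have [] := gJ_ x.
have gJu' x : g (J x) u = - g x (J u) by have [] := gJ_ x.
have gJl x y : g (J x) y = - g x (J y) by rewrite -gJ JJ (ipE ip).
have brg x y w : g (br x y) w = g x (J e) * g (D y) w - g y (J e) * g (D x) w +
    c * (g x u * g y (J u) - g y u * g x (J u)) * g e w.
  by rewrite brE !(ipE ip).
do 2![split=> //] => x y; apply: (ip_inj ip) => w.
rewrite !(ipBl ip) (ip0l ip) !(gJl (br _ _)) !brg !DJ !(gJe, gJu, gJu').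
by rewrite !(gJl (D _)) !JJ !(ipNr ip); ring.
Qed.

(** Since $DJ$ is symmetric, the torsion is $e^*\wedge\eta$ with $\eta=c\,u^*\wedge(Ju)^*$. Moreover
    $de^*=-\eta$, and $d\eta=0$ by $D$-invariance, so its differential is $-\eta\wedge\eta=0$. *)
Lemma nf_SKT (R : realType) (V : vectType R) (br : V -> V -> V)
    (J : 'End(V)) (g : V -> V -> R) (D : 'End(V)) (e u : V) (b c : R) :
  normal_form br J g D e u b c -> SKT br J g.
Proof.
move=> nf; apply/(SKT_bismut (nf_lie_bracket nf) (nf_hermitian nf)).
have [gDe gDu gJ_ [eJe uJu] [eu eJu DJe]] := nf_eval nf.
case: nf => ip JJ gJ DJ Dg De Du ee uu ue uJe _ _ brE.
have gDe1 x := (gDe x).1; have gDe2 x := (gDe x).2.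
have gDu1 x := (gDu x).1; have gDu2 x := (gDu x).2.
have gJe x : g (J x) (J e) = g x e by have [] := gJ_ x.
have gJu x : g (J x) (J u) = g x u by have [] := gJ_ x.
have gJu' x : g (J x) u = - g x (J u) by have [] := gJ_ x.
have JDs x y : g (J (D x)) y = g (J (D y)) x.
  by rewrite -gJ JJ (ipNl ip) Dg opprK DJ (ipC ip).
pose eta x y := c * (g x u * g y (J u) - g y u * g x (J u)).
have torsionE x y z : bismut_torsion br J g x y z =
    g x e * eta y z + g y e * eta z x + g z e * eta x y.
  rewrite /bismut_torsion !brE !DJ !(ipE ip) !(gJe, gJu, gJu').
  by rewrite (JDs z x) (JDs z y) (JDs y x) /eta !(ipC ip e); ring.
have brg x y w : g (br x y) w = g x (J e) * g (D y) w - g y (J e) * g (D x) w +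
    c * (g x u * g y (J u) - g y u * g x (J u)) * g e w.
  by rewrite brE !(ipE ip).
move=> x y z w; rewrite !torsionE /eta !brg.
by rewrite !(gDe1, gDe2, gDu1, gDu2, ee, eu, eJu, eJe); ring.
Qed.

Lemma nf_nilradical (R : realType) (V : vectType R) (br : V -> V -> V)
    (J : 'End(V)) (g : V -> V -> R) (D : 'End(V)) (e u : V) (b c : R)
    (N : {vspace V}) :
    normal_form br J g D e u b c ->
    (forall x, (x \in N) = (g x (J e) == 0)) ->
  [/\ is_nilradical br N, lower_central br N 1 = <[e]>%VS &
      J_derived_eq_orth br N J g].
Proof.
move=> nf NE; have L := nf_lie_bracket nf.
have [gDe gDu gJ_ [eJe uJu] [eu eJu DJe]] := nf_eval nf.
case: nf => ip JJ gJ DJ Dg De Du ee uu ue uJe c0 [v0 Dv0] brE.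
have gJe x : g (J x) (J e) = g x e by have [] := gJ_ x.
have gJu' x : g (J x) u = - g x (J u) by have [] := gJ_ x.
have brN x y : x \in N -> y \in N ->
    br x y = (c * (g x u * g y (J u) - g y u * g x (J u))) *: e.
  by rewrite !NE brE => /eqP -> /eqP ->; rewrite !scale0r subr0 add0r.
have N1 : lower_central br N 1 = <[e]>%VS.
  apply/eqP; rewrite eqEsubv /= lie_prod_subv => [|x y xN yN]; last first.
    by rewrite brN // memvZ ?memv_line.
  have -> : e = c^-1 *: br u (J u).
    rewrite brN ?NE ?uJe ?gJe ?ue // uJu gJ uu gJu' uJu.
    by rewrite oppr0 mul0r subr0 !mulr1 scalerA mulVf ?scale1r.
  by rewrite -memvE memvZ ?memv_lie_prod ?NE ?uJe ?gJe ?ue.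
have brXN x y : br x y \in N.
  by rewrite NE brE !(ipE ip) !(gDe _).2 eJe !mulr0 subr0 addr0.
split=> //; last first.
  move=> v; rewrite N1 limg_line; split=> [/vlineP[k ->] x|vN].
    by rewrite NE (ipE ip) (ipC ip) => /eqP ->; rewrite mulr0.
  apply/vlineP; exists (g v (J e)); apply/eqP; rewrite -subr_eq0.
  set w := v - _; have wN : w \in N.
    by rewrite NE /w !(ipE ip) gJ ee mulr1 subrr.
  rewrite -(ip_eq0 ip) {1}/w (ipBl ip) (ipZl ip) vN // (ipC ip (J e)).
  by move: wN; rewrite NE => /eqP ->; rewrite mulr0 subrr.
split; first by move=> x y _; exact: brXN.
  exists 2; apply/eqP; rewrite -subv0; apply: lie_prod_subv => x y xN.
  rewrite -[lie_prod _ _ _]/(lower_central br N 1) N1 => /vlineP[k ->].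
  have keN : k *: e \in N by rewrite memvZ // NE eJe.
  rewrite brN // !(ipE ip) eu eJu !mulr0 mul0r subr0 mulr0.
  by rewrite scale0r mem0v.
move=> M iM [l Ml0]; apply/subvP => y yM; rewrite NE; apply: contraT => ty0.
(* Skewness gives $|Dx|^2=-g(x,D^2x)$. *)
have D2 x : D (D x) == 0 -> D x == 0.
  by rewrite -!(ip_eq0 ip (D x)) Dg => /eqP ->; rewrite (ip0r ip) oppr0.
have Dbr x : x \in N -> D (br y x) = g y (J e) *: D (D x).
  rewrite NE brE => /eqP ->; rewrite scale0r subr0 linearD !linearZ /= De.
  by rewrite scaler0 addr0.
have DN x : D x \in N by rewrite NE (gDe _).2.
(* A skew operator has no nilpotent part, so bracketing with [y] never kills [D w]. *)
suff [w [wM _ Dw]] : exists w, [/\ w \in lower_central br M l, w \in N & D w != 0].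
  by move: wM; rewrite Ml0 memv0 => /eqP w0; rewrite w0 linear0 eqxx in Dw.
elim: l {Ml0} => [|l [w [wM wN Dw]]].
  (* The start must lie in both [M] and [N]. This bracket does, as [M] is an ideal containing [y];
     since [D v0] is in [N], applying [D] to it gives a nonzero multiple of $D^3v_0$. *)
  exists (br y (D v0)); split=> //; first last.
  - rewrite Dbr // scaler_eq0 negb_or ty0; apply: contra Dv0 => /D2/D2.
    by [].
  - by rewrite (lie_anti L) memvN iM.
exists (br y w); split=> //; first by rewrite memv_lie_prod.
by rewrite Dbr // scaler_eq0 negb_or ty0; apply: contra Dw => /D2.
Qed.

(** The hypotheses are the real and imaginary parts of $(a+ib)(x+iy)=0$; multiplying by $a-ib$
    leaves $a^2+b^2\neq0$. *)
Lemma rotation_eq0 (R : realType) (V : lmodType R) (a b : R) (x y : V) :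
  a != 0 -> a *: x - b *: y = 0 -> b *: x + a *: y = 0 -> x = 0 /\ y = 0.
Proof.
move=> a0 e1 e2; have d0 : a ^+ 2 + b ^+ 2 != 0.
  by rewrite gt_eqF // ltr_wpDr ?sqr_ge0 // lt_neqAle eq_sym expf_neq0 ?sqr_ge0.
split; apply: (scalerI d0); rewrite scaler0.
- transitivity (a *: (a *: x - b *: y) + b *: (b *: x + a *: y)).
    by rewrite scalerBr scalerDr !scalerA (mulrC b a) addrACA addNr addr0 -scalerDl.
  by rewrite e1 e2 !scaler0 addr0.
- transitivity (a *: (b *: x + a *: y) - b *: (a *: x - b *: y)).
    rewrite scalerBr scalerDr !scalerA (mulrC b a) opprB [RHS]addrC -[RHS]addrA.
    by rewrite addKr [RHS]addrC -scalerDl.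
  by rewrite e1 e2 !scaler0 subr0.
Qed.

(** Let $v+iw$ be an eigenvector with $\mathrm{Re}\,z\neq0$ and $\theta=g(\cdot,Je)$. Brackets lie
    in $\ker\theta$, so $\theta$ kills $v,w$. There $D\,\mathrm{ad}_x=\theta(x)D^2$, and a skew
    operator has no such eigenvalue, so $Dv=Dw=0$. Finally $\mathrm{ad}_x^2=0$ on
    $\ker\theta\cap\ker D$. *)
Lemma nf_type_I (R : realType) (V : vectType R) (br : V -> V -> V)
    (J : 'End(V)) (g : V -> V -> R) (D : 'End(V)) (e u : V) (b c : R) :
  normal_form br J g D e u b c -> type_I br.
Proof.
move=> nf; have L := nf_lie_bracket nf.
have [gDe gDu gJ_ [eJe uJu] [eu eJu DJe]] := nf_eval nf.
case: nf => ip JJ gJ DJ Dg De Du ee uu ue uJe c0 _ brE x z.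
have [Dl Dr Zl Zr] := lie_linear L.
have fE v : linfun (br x) v = br x v.
  pose F : {linear V -> V} :=
    HB.pack (br x) (GRing.isLinear.Build R V V _ (br x) (lie_linear_r L x)).
  by rewrite -[br x]/(F : V -> V) lfunE.
case/complex_eigenvector => v [w []].
set a := complex.Re z; set b' := complex.Im z; rewrite !fE => vw fv fw.
apply/eqP; apply: contraT => a0.
have theta_br y : g (br x y) (J e) = 0.
  by rewrite brE !(ipE ip) !(gDe _).2 eJe !mulr0 subr0 addr0.
have [tv tw] : g v (J e) = 0 /\ g w (J e) = 0.
  apply: (@rotation_eq0 R R^o a b' _ _ a0).
    by rewrite -(theta_br v) fv !(ipE ip).
  by rewrite -(theta_br w) fw !(ipE ip).
have Dbr y : g y (J e) = 0 -> D (br x y) = g x (J e) *: D (D y).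
  by move=> ty; rewrite brE ty scale0r subr0 linearD !linearZ /= De scaler0 addr0.
have DD0 y : g (D (D y)) (D y) = 0.
  by have := Dg (D y) (D y); rewrite (ipC ip) => ?; lra.
have [Dv Dw] : D v = 0 /\ D w = 0.
  have ev := Dbr v tv; have ew := Dbr w tw.
  have DZ k y : D (k *: y) = k *: D y by rewrite linearZ.
  rewrite fv linearB /= !DZ in ev; rewrite fw linearD /= !DZ in ew.
  have hv : g (a *: D v - b' *: D w) (D v) = 0 by rewrite ev (ipZl ip) DD0 mulr0.
  have hw : g (b' *: D v + a *: D w) (D w) = 0 by rewrite ew (ipZl ip) DD0 mulr0.
  move: hv hw; rewrite !(ipE ip) (ipC ip (D w)) => hv hw.
  have : a * (g (D v) (D v) + g (D w) (D w)) == 0 by apply/eqP; lra.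
  rewrite mulf_eq0 (negbTE a0) paddr_eq0 ?(ip_ge0 ip) // !(ip_eq0 ip) /=.
  by case/andP=> /eqP ? /eqP.
have br2 y : g y (J e) = 0 -> D y = 0 -> br x (br x y) = 0.
  move=> ty Dy; rewrite [br x y]brE ty Dy scale0r scaler0 subr0 add0r Zr brE.
  rewrite De eJe eu eJu scaler0 scale0r subr0 !mulr0 mul0r subr0 mulr0.
  by rewrite scale0r addr0 scaler0.
have Nr y : br x (- y) = - br x y by rewrite -scaleN1r Zr scaleN1r.
have [bv bw] : br x v = 0 /\ br x w = 0.
  apply: (rotation_eq0 a0).
    by rewrite -[RHS](br2 v tv Dv) fv Dr Nr !Zr -fv.
  by rewrite -[RHS](br2 w tw Dw) fw Dr !Zr -fw.
have [v0 w0] := rotation_eq0 a0 (etrans (esym fv) bv) (etrans (esym fw) bw).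
by move: vw; rewrite v0 w0 eqxx.
Qed.

(** The case of the zero operator in [unitary_eigenbasis]; the Boolean in the index chooses between
    $u_j$ and $Ju_j$. *)
Lemma orthonormal_basis (R : realType) (V : vectType R) (g : V -> V -> R)
    (J : 'End(V)) :
    inner_product g -> (forall x, J (J x) = - x) ->
    (forall x y, g (J x) (J y) = g x y) ->
  exists (I : finType) (w : I -> V), forall v, v = \sum_i g v (w i) *: w i.
Proof.
move=> ip JJ gJ.
have [||||m [u [_ [_ _ _ _ uE]]]] :=
    @unitary_eigenbasis R V g J 0%VF fullv ip JJ gJ _ _ _ _.
- by move=> x y; rewrite !lfunE /= !(ipE ip).
- by move=> x; rewrite !lfunE /= linear0.
- by move=> x _; rewrite memvf.
- by move=> x _; rewrite memvf.
exists (bool * 'I_m)%type, (fun k : bool * 'I_m => if k.1 then J (u k.2) else u k.2) => v.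
pose F (i : bool) (j : 'I_m) := let x := if i then J (u j) else u j in g v x *: x.
transitivity (\sum_i \sum_j F i j); last by rewrite pair_big.
by rewrite big_bool /= {1}(uE v (memvf v)) big_split addrC.
Qed.

(* With [a_ij = g (D w_i) w_j], the sum over [i] of the hypothesis at [w_i] is half
   the sum of the squares of [a_ij + a_ji]. *)
Lemma skew_of_affine_norm (R : realType) (V : vectType R) (g : V -> V -> R)
    (D : 'End(V)) (I : finType) (w : I -> V) :
    inner_product g -> (forall v, v = \sum_i g v (w i) *: w i) ->
    (forall x, g (D (D x)) x + g (D x) (D x) = 0) ->
  forall x y, g (D x) y = - g x (D y).
Proof.
move=> ip wE D2; pose a i j := g (D (w i)) (w j).
have DwE i : D (w i) = \sum_j a i j *: w j by exact: wE.
have sum0 : \sum_i \sum_j (a i j + a j i) ^+ 2 = 0.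
  have h : \sum_i \sum_j (a i j * a j i + a i j ^+ 2) = 0.
    rewrite big1 // => i _; rewrite -[RHS](D2 (w i)) big_split /=; congr (_ + _).
      rewrite DwE linear_sum (ip_suml ip); apply: eq_bigr => j _.
      by rewrite linearZ /= (ipZl ip).
    rewrite {1}DwE (ip_suml ip); apply: eq_bigr => j _.
    by rewrite (ipZl ip) (ipC ip).
  transitivity (\sum_i \sum_j (a i j * a j i + a i j ^+ 2) +
    \sum_i \sum_j (a i j * a j i + a i j ^+ 2)); last by rewrite h addr0.
  rewrite [X in _ = _ + X]exchange_big -big_split; apply: eq_bigr => i _.
  by rewrite -big_split; apply: eq_bigr => j _ /=; ring.
have aC i j : a i j = - a j i.
  apply/eqP; rewrite -addr_eq0 -sqrf_eq0; apply/eqP.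
  have sq_ge0 k l : 0 <= (a k l + a l k) ^+ 2 by exact: sqr_ge0.
  have /psumr_eq0P -/(_ (fun k _ => sumr_ge0 _ (fun l _ => sq_ge0 k l))) h := sum0.
  by have /psumr_eq0P -/(_ (fun l _ => sq_ge0 i l)) -> := h i isT.
have Dw i y : g (D (w i)) y = - g (w i) (D y).
  rewrite (wE y) linear_sum !(ipC ip _ (\sum_i _)) !(ip_suml ip) -sumrN.
  apply: eq_bigr => j _; rewrite linearZ /= !(ipZl ip) (ipC ip (w j)).
  by rewrite -[g (D _) _]/(a i j) -[g (D _) _]/(a j i) aC mulrN.
move=> x y; rewrite (wE x) linear_sum !(ip_suml ip) -sumrN.
by apply: eq_bigr => i _; rewrite linearZ /= !(ipZl ip) Dw mulrN.
Qed.

(** * From SKT structures to the normal form *)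

Lemma lie_ideal_prod (R : fieldType) (V : vectType R) (br : V -> V -> V)
    (U W : {vspace V}) :
  lie_bracket br -> lie_ideal br U -> lie_ideal br W ->
  lie_ideal br (lie_prod br U W).
Proof.
move=> L iU iW x z; have [h hE] := linear_hom (lie_linear_r L x).
have [Dl Dr Zl Zr] := lie_linear L.
have : (lie_prod br U W <= h @^-1: lie_prod br U W)%VS.
  apply: lie_prod_subv => u w uU wW; rewrite -memv_preim hE.
  have /eqP := lie_jacobi L x u w.
  rewrite -addrA addr_eq0 => /eqP ->; rewrite rpredN rpredD //.
    by rewrite (lie_anti L w x) -scaleN1r Zr rpredZ // memv_lie_prod // iW.
  by rewrite (lie_anti L w) rpredN memv_lie_prod // iU.
by move=> /subvP sub /sub; rewrite -memv_preim hE.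
Qed.

(** $\mathfrak n^2$ lies in the line $\mathfrak n^1$; if it were the whole line, the lower central
    series would be constant from there on. So $\mathfrak n^2=0$, and for $l=1$ the trace on
    $\mathfrak n^1/\mathfrak n^2$ is the single eigenvalue of $\mathrm{ad}_x$ on that line. *)
Lemma derived_line_central (R : fieldType) (V : vectType R) (br : V -> V -> V)
    (N : {vspace V}) :
    lie_bracket br -> lie_ideal br N -> lie_nilpotent br N ->
    strongly_unimodular br N -> \dim (lower_central br N 1) = 1%N ->
  forall x e, e \in lower_central br N 1 -> br x e = 0.
Proof.
move=> L iN [l Nl] SU dN1.
have iN1 : lie_ideal br (lower_central br N 1) by exact: lie_ideal_prod.
have N20 : lower_central br N 2 = 0%VS.
  have N21 : (lower_central br N 2 <= lower_central br N 1)%VS.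
    by apply: lie_prod_subv => x y _; exact: iN1.
  have [//|N20] := eqVneq (lower_central br N 2) 0%VS.
  have {}N21 : lower_central br N 2 = lower_central br N 1.
    by apply/eqP; rewrite eqEdim N21 dN1 lt0n dimv_eq0.
  have Nk k : lower_central br N k.+1 = lower_central br N 1.
    by elim: k => // k IHk; rewrite -[LHS]/(lie_prod br N (lower_central br N k.+1)) IHk.
  have : (lower_central br N l.+1 <= 0)%VS.
    rewrite /= Nl; apply: lie_prod_subv => x y _; rewrite memv0 => /eqP ->.
    by have [_ _ _ Zr] := lie_linear L; rewrite -(scale0r x) Zr scale0r mem0v.
  by rewrite Nk subv0 -dimv_eq0 dN1.
move=> x; move: (lower_central br N 1) (SU x 1%N) dN1 iN1; rewrite N20.
move=> U; rewrite /quotient_trace => tr0 dU iU.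
have UD : (U :\: 0)%VS = U by rewrite -[LHS]addv0 addv_diff addv0.
have pi1U v : v \in U -> addv_pi1 U 0 v = v.
  move=> vU; rewrite -{2}(@addv_pi1_pi2 _ _ U 0 v) ?addv0 //.
  by have := memv_pi2 U 0 v; rewrite memv0 => /eqP ->; rewrite addr0.
have [p p0 Up] : exists2 p, p \in U & U = <[p]>%VS.
  exists (vpick U); rewrite ?memv_pick //; apply/esym/eqP.
  by rewrite eqEdim -memvE memv_pick dU dim_vline vpick0 -dimv_eq0 dU.
have /vlineP[t brp] : br x p \in <[p]>%VS by rewrite -Up iU.
have brU v : v \in U -> br x v = t *: v.
  have [_ _ _ Zr] := lie_linear L.
  by rewrite {1}Up => /vlineP[k ->]; rewrite Zr brp !scalerA mulrC.
suff t0 : t = 0 by move=> v /brU ->; rewrite t0 scale0r.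
set B := vbasis (U :\: 0) in tr0.
have BU (i : 'I_(\dim (U :\: 0))) : B`_i \in U.
  by apply: (subvP (diffvSl U 0)); rewrite vbasis_mem ?mem_nth ?size_tuple.
have : \sum_(i < \dim (U :\: 0)) t = 0.
  rewrite -[RHS]tr0; apply: eq_bigr => i _; rewrite mxE brU // pi1U ?rpredZ //.
  by rewrite linearZ /= coord_free ?(basis_free (vbasisP _)) // eqxx mulr1.
by rewrite sumr_const card_ord UD dU.
Qed.

Lemma bismut_torsionE (R : realType) (V : vectType R) (br : V -> V -> V)
    (J : 'End(V)) (g : V -> V -> R) (D : 'End(V)) (e : V) (eta : V -> V -> R) :
    inner_product g -> (forall x y, g (J x) (J y) = g x y) ->
    (forall x y, eta (J x) (J y) = eta x y) ->
    (forall x y, br x y =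
      g x (J e) *: D y - g y (J e) *: D x + eta x y *: e) ->
  let gamma x y := eta x y + g (D (J x)) y - g (D (J y)) x in
  forall x y z, bismut_torsion br J g x y z =
    g x e * gamma y z + g y e * gamma z x + g z e * gamma x y.
Proof.
move=> ip gJ etaJ brE gamma x y z; rewrite /bismut_torsion /gamma !brE.
by rewrite !(ipE ip) !etaJ !gJ !(ipC ip e); ring.
Qed.

(** The conclusion says that $|\exp(tD)x|^2$ has zero second derivative in $t$, hence is affine in
    $t$. *)
Lemma SKT_affine_norm (R : realType) (V : vectType R) (br : V -> V -> V)
    (J : 'End(V)) (g : V -> V -> R) (D : 'End(V)) (e : V) (eta : V -> V -> R) :
    lie_bracket br -> SKT br J g ->
    (forall x, D (J x) = J (D x)) -> g e e = 1 -> D e = 0 ->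
    (forall x, g (D x) e = 0) -> (forall x, g (D x) (J e) = 0) ->
    (forall x y, eta x y = g (br x y) e) ->
    (forall x, eta e x = 0) -> (forall x y, eta (J x) (J y) = eta x y) ->
    (forall x y, eta (D x) y + eta x (D y) = 0) ->
    (forall x y, br x y =
      g x (J e) *: D y - g y (J e) *: D x + eta x y *: e) ->
  forall x, g (D (D x)) x + g (D x) (D x) = 0.
Proof.
move=> L S DJ ee De gDe gDJe etaE etae etaJ etaD brE x.
have [H _] := S; have [[JJ _] ip gJ] := H.
have gJl p q : g (J p) q = - g p (J q) by rewrite -gJ JJ (ipE ip).
have gJ0 p : g p (J p) = 0.
  by have := gJl p p; rewrite (ipC ip) => ?; lra.
have etaC p q : eta p q = - eta q p by rewrite !etaE (lie_anti L) (ipE ip).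
have etaJe p : eta (J e) p = 0.
  by rewrite -[p]opprK -JJ etaJ etae.
have bre p : br e p = 0 by rewrite brE gJ0 De etae scale0r scaler0 subrr scale0r addr0.
have brJe p : br (J e) p = D p.
  by rewrite brE gJ ee DJ De linear0 etaJe scale1r scaler0 subr0 scale0r addr0.
pose gam p q := eta p q + g (D (J p)) q - g (D (J q)) p.
have torsionE := bismut_torsionE ip gJ etaJ brE; rewrite -/gam in torsionE.
have gamC p q : gam p q = - gam q p by rewrite /gam (etaC p q); ring.
have game p : gam e p = 0.
  by rewrite /gam etae gDe DJ De linear0 (ip0l ip) subr0 addr0.
have gamJe p : gam (J e) p = 0.
  by rewrite /gam etaJe gDJe JJ linearN /= De oppr0 (ip0l ip) subr0 addr0.
have gam0 p : gam 0 p = 0.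
  have [_ _ Zl _] := lie_linear L.
  by rewrite /gam etaE -(scale0r e) Zl !scale0r !linear0 !(ipE ip) subr0 addr0.
(* As $e$ is central and $\mathrm{ad}_{Je}=D$, only $\gamma(DJx,x)+\gamma(Jx,Dx)=0$ is left. Its
   $\eta$ part vanishes by invariance, and the rest is $-2$ times the claim. *)
have := (SKT_bismut L H).1 S e (J e) (J x) x.
rewrite !bre !brJe !torsionE !(gamC _ e) !(gamC _ (J e)) !(gamC _ 0).
rewrite !game !gamJe !gam0 !gDe (ip0l ip) ee /gam !DJ !JJ.
have := etaD (J x) x; rewrite DJ (etaC (J (D x))) (etaC _ x).
by rewrite !(ipNl ip) !gJ !gJl => ? ?; lra.
Qed.

(** The conclusion is $\eta\wedge\eta=0$ on four vectors, arranged as a Plücker relation. *)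
Lemma SKT_eta_wedge (R : realType) (V : vectType R) (br : V -> V -> V)
    (J : 'End(V)) (g : V -> V -> R) (D : 'End(V)) (e : V) (eta : V -> V -> R) :
    lie_bracket br -> SKT br J g ->
    (forall x, D (J x) = J (D x)) -> g e e = 1 -> g e (J e) = 0 ->
    (forall x, g (D x) e = 0) -> (forall x, eta e x = 0) ->
    (forall x y, g (D x) y = - g x (D y)) ->
    (forall x y, eta x y = g (br x y) e) ->
    (forall x y, eta (J x) (J y) = eta x y) ->
    (forall x y, eta (D x) y + eta x (D y) = 0) ->
    (forall x y, br x y =
      g x (J e) *: D y - g y (J e) *: D x + eta x y *: e) ->
  forall x y z w, eta x y * eta z w = eta x z * eta y w - eta x w * eta y z.
Proof.
move=> L S DJ ee eJe gDe etae Dg etaE etaJ etaD brE x y z w.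
have [H _] := S; have [[JJ _] ip gJ] := H.
have gJl p q : g (J p) q = - g p (J q) by rewrite -gJ JJ (ipE ip).
have etaC p q : eta p q = - eta q p by rewrite !etaE (lie_anti L) (ipE ip).
have torsionE p q r : bismut_torsion br J g p q r =
    g p e * eta q r + g q e * eta r p + g r e * eta p q.
  have JDs a b : g (D (J a)) b = g (D (J b)) a.
    by rewrite Dg gJl opprK (ipC ip) DJ.
  rewrite (bismut_torsionE ip gJ etaJ brE).
  by rewrite (JDs q r) (JDs r p) (JDs p q); ring.
have [Dl Dr Zl Zr] := lie_linear L.
have eta_br p q r : eta (br p q) r =
    g p (J e) * eta (D q) r - g q (J e) * eta (D p) r + eta p q * eta e r.
  rewrite [br p q]brE !etaE Dl Zl -scaleN1r Dl !Zl.
  by rewrite !(ipE ip); ring.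
have etaDr p q : eta p (D q) = - eta (D p) q by apply/eqP; rewrite -addr_eq0 addrC etaD.
have := (SKT_bismut L H).1 S x y z w; rewrite !torsionE.
rewrite !(etaC _ (br _ _)) !eta_br !etae !brE !(ipE ip) !gDe ee.
(* This symmetry brings all terms with [D] to a common order, after which they cancel linearly. *)
have Dc p q : eta (D p) q = eta (D q) p by rewrite -[LHS]opprK -etaDr -etaC.
rewrite (Dc z w) (Dc y w) (Dc y z) (Dc x w) (Dc x z) (Dc x y).
by move=> ?; lra.
Qed.

Lemma riesz_vector (R : realType) (V : vectType R) (g : V -> V -> R)
    (J : 'End(V)) (f : V -> R) :
    inner_product g -> (forall x, J (J x) = - x) ->
    (forall x y, g (J x) (J y) = g x y) -> scalar f ->
  exists h, forall v, f v = g v h.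
Proof.
move=> ip JJ gJ lf; have [I [w wE]] := orthonormal_basis ip JJ gJ.
have [F FE] := @linear_hom _ V R^o f lf.
exists (\sum_i f (w i) *: w i) => v; rewrite -FE {1}(wE v) linear_sum.
rewrite (ipC ip) (ip_suml ip); apply: eq_bigr => i _.
by rewrite linearZ /= FE (ipZl ip) mulrC (ipC ip).
Qed.

(* [eta /\ eta = 0] and [J]-invariance make [eta] a multiple of [h^* /\ (J h)^*]
   for the vector [h] dual to [eta y0], where [eta y0 (J y0) != 0]. *)
Lemma decomposable_form (R : realType) (V : vectType R) (g : V -> V -> R)
    (J D : 'End(V)) (e x0 y0 : V) (eta : V -> V -> R) :
    inner_product g -> (forall x, J (J x) = - x) ->
    (forall x y, g (J x) (J y) = g x y) ->
    (forall x, D (J x) = J (D x)) -> (forall x y, g (D x) y = - g x (D y)) ->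
    (forall x, scalar (eta x)) -> (forall x y, eta x y = - eta y x) ->
    (forall x, eta e x = 0) -> (forall x y, eta (J x) (J y) = eta x y) ->
    (forall x y, eta (D x) y + eta x (D y) = 0) ->
    (forall x y z w, eta x y * eta z w = eta x z * eta y w - eta x w * eta y z) ->
    eta x0 y0 != 0 ->
  exists u b c, [/\ g u u = 1, g u e = 0 /\ g u (J e) = 0, D u = b *: J u, c != 0 &
    forall x y, eta x y = c * (g x u * g y (J u) - g y u * g x (J u))].
Proof.
move=> ip JJ gJ DJ Dg lin etaC etae etaJ etaD wedge eta00.
have gJl p q : g (J p) q = - g p (J q) by rewrite -gJ JJ (ipE ip).
have gJ0 p : g p (J p) = 0.
  by have := gJl p p; rewrite (ipC ip) => ?; lra.
have eta0 x : eta x 0 = 0.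
  by have := lin x 1 0 0; rewrite scaler0 addr0 => ?; lra.
have etaDr x y z : eta x (y + z) = eta x y + eta x z.
  by have := lin x 1 y z; rewrite scale1r mul1r.
have etaN x y : eta x (- y) = - eta x y.
  by have := lin x (-1) y 0; rewrite scaleN1r mulN1r eta0 !addr0.
have etaDl x y z : eta (x + y) z = eta x z + eta y z.
  by rewrite etaC etaDr (etaC x) (etaC y) opprD.
(* By $J$-invariance $\eta(y,Jz)$ is symmetric in $y,z$, so if it vanished on the diagonal,
   polarization would give $\eta=0$. *)
have [y1 r0] : exists y, eta y (J y) != 0.
  apply: contrapT => no; case/negP: eta00; apply/eqP.
  have nJ y : eta y (J y) = 0.
    by apply/eqP; apply: contrapT => /negP ?; apply: no; exists y.
  have eta_J y z : eta y (J z) = 0.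
    have := nJ (y + z); rewrite linearD /= !etaDr !etaDl !nJ.
    by rewrite -(etaJ z (J y)) JJ etaN -etaC => ?; lra.
  by rewrite -[y0]opprK -JJ eta_J.
have [h hE] := riesz_vector ip JJ gJ (lin y1).
have qE v : eta (J y1) v = g v (J h).
  by rewrite -{1}[v]opprK -JJ etaJ hE gJl (ipNl ip) opprK.
set r := eta y1 (J y1) in r0.
(* The Plücker relation at $(y_1,Jy_1,x,y)$, divided by $r$. *)
have etaE x y : eta x y = r^-1 * (g x h * g y (J h) - g y h * g x (J h)).
  by rewrite -!hE -!qE -wedge mulrA mulVf ?mul1r.
have h0 : h != 0 by apply: contraNneq r0 => h0; rewrite /r hE h0 (ip0r ip).
have gh0 : g h h != 0 by rewrite (ip_eq0 ip).
pose k := Num.sqrt (g h h); have kk : k ^+ 2 = g h h by rewrite sqr_sqrtr ?(ip_ge0 ip).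
have k0 : k != 0 by apply: contraNneq gh0 => k0; rewrite -kk k0 expr0n.
have [u uE] : exists u, u = k^-1 *: h by exists (k^-1 *: h).
have uh : h = k *: u by rewrite uE scalerA mulfV ?scale1r.
have guu : g u u = 1 by rewrite uE !(ipE ip) -kk; field.
have etaEu x y :
    eta x y = (r^-1 * g h h) * (g x u * g y (J u) - g y u * g x (J u)).
  by rewrite etaE -kk uh linearZ /= !(ipE ip); ring.
have c0 : r^-1 * g h h != 0 by rewrite mulf_neq0 ?invr_eq0.
have gue : g u e = 0.
  by rewrite uE (ipZl ip) (ipC ip) -hE etaC etae oppr0 mulr0.
have guJe : g u (J e) = 0.
  by rewrite (ipC ip) gJl uE linearZ /= (ipZr ip) -qE etaC etae oppr0 mulr0 oppr0.
have gJuu : g (J u) u = 0 by rewrite gJl gJ0 oppr0.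
exists u, (g (D u) (J u)), (r^-1 * g h h); split=> //.
(* This $v$ is orthogonal to $u$ and $Ju$, so invariance of $\eta$ at $(Ju,v)$ reads $g(Dv,u)=0$;
   skewness turns $|v|^2$ into $-g(u,Dv)$. *)
pose v := D u - g (D u) (J u) *: J u.
have guDu : g (D u) u = 0 by have := Dg u u; rewrite (ipC ip u) => ?; lra.
have vu : g v u = 0 by rewrite /v !(ipE ip) guDu gJuu mulr0 subr0.
have vJu : g v (J u) = 0 by rewrite /v !(ipE ip) gJ guu mulr1 subrr.
have uDv : g u (D v) = 0.
  have := etaD (J u) v; rewrite !etaEu vu vJu gJuu gJ guu => e1.
  have /eqP : (r^-1 * g h h) * g (D v) u = 0 by lra.
  by rewrite mulf_eq0 (negbTE c0) /= => /eqP; rewrite (ipC ip).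
apply/eqP; rewrite -subr_eq0 -/v -(ip_eq0 ip) {1}/v (ipBl ip) (ipZl ip).
by rewrite (Dg u v) uDv (ipC ip (J u) v) vJu mulr0 !oppr0 addr0.
Qed.

Lemma SKT_normal_form (R : realType) (V : vectType R) (br : V -> V -> V)
    (N : {vspace V}) (J : 'End(V)) (g : V -> V -> R) :
    lie_bracket br -> is_nilradical br N -> almost_nilpotent br N ->
    strongly_unimodular br N -> \dim (lower_central br N 1) = 1%N ->
    SKT br J g -> J_derived_eq_orth br N J g ->
  exists D e u b c, normal_form br J g D e u b c.
Proof.
move=> L [iN nilN maxN] [_ dN] SU dN1 S JN.
have cent := derived_line_central L iN nilN SU dN1.
have iN1 : lie_ideal br (lower_central br N 1) by exact: lie_ideal_prod.
have brN x y : x \in N -> y \in N -> br x y \in lower_central br N 1.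
  by move=> *; exact: memv_lie_prod.
have brN0 : ~ forall x y, x \in N -> y \in N -> br x y = 0.
  move=> br0; have : (lower_central br N 1 <= 0)%VS.
    by apply: lie_prod_subv => x y xN yN; rewrite br0 // mem0v.
  by move=> /dimvS; rewrite dN1 dimv0.
rewrite /J_derived_eq_orth in JN.
move: (lower_central br N 1) JN dN1 cent iN1 brN => N1 JN dN1 cent iN1 brN.
have [[[JJ NJ] ip gJ] _] := S.
have gJl p q : g (J p) q = - g p (J q) by rewrite -gJ JJ (ipE ip).
have gJ0 p : g p (J p) = 0.
  by have := gJl p p; rewrite (ipC ip) => ?; lra.
have [e eN1 ee] : exists2 e, e \in N1 & g e e = 1.
  have p0 : vpick N1 != 0 by rewrite vpick0 -dimv_eq0 dN1.
  exists ((Num.sqrt (g (vpick N1) (vpick N1)))^-1 *: vpick N1).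
    by rewrite rpredZ // memv_pick.
  rewrite !(ipE ip) -{3}(sqr_sqrtr (ip_ge0 ip (vpick N1))) expr2.
  have : Num.sqrt (g (vpick N1) (vpick N1)) != 0.
    by rewrite gt_eqF // sqrtr_gt0 (ip_pos ip).
  by move=> ?; field.
have e0 : e != 0 by rewrite -(ip_eq0 ip) ee oner_eq0.
have N1E : N1 = <[e]>%VS.
  by apply/esym/eqP; rewrite eqEdim -memvE eN1 dN1 dim_vline e0.
have [K KE] := orth_vspace (J e) ip.
(* [JN] puts [N] inside $(Je)^\perp$, which is a proper subspace; codimension one forces
   equality. *)
have NK : N = K.
  apply/eqP; rewrite eqEdim; apply/andP; split.
    apply/subvP => x xN; rewrite KE (ipC ip); apply/eqP.
    by apply: (JN (J e)).1 => //; apply: memv_img.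
  rewrite -ltnS dN ltn_neqAle dimvS ?subvf // andbT; apply/negP => /eqP dK.
  have : (J e \in K); last by rewrite KE gJ ee oner_eq0.
  have -> : K = fullv by apply/eqP; rewrite eqEdim subvf dK leqnn.
  exact: memvf.
have NE x : (x \in N) = (g x (J e) == 0) by rewrite NK KE.
have [Dl Dr Zl Zr] := lie_linear L.
have Nl x y : br (- x) y = - br x y by rewrite -scaleN1r Zl scaleN1r.
have Nr x y : br x (- y) = - br x y by rewrite -scaleN1r Zr scaleN1r.
have bre x : br x e = 0 by exact: cent.
have bre' x : br e x = 0 by rewrite (lie_anti L) bre oppr0.
have [D DE] := linear_hom (lie_linear_r L (J e)).
have De : D e = 0 by rewrite DE bre.
have DJe : D (J e) = 0 by rewrite DE (lie_alternating L).
pose pr x := x - g x (J e) *: J e.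
have prN x : pr x \in N by rewrite NE /pr !(ipE ip) gJ ee mulr1 subrr.
have gDJe x : g (D x) (J e) = 0.
  apply/eqP; rewrite -NE; have -> : D x = D (pr x).
    have DZ k y : D (k *: y) = k *: D y by rewrite linearZ.
    by rewrite /pr linearB /= DZ DJe scaler0 subr0.
  by rewrite DE iN.
have DJ x : D (J x) = J (D x).
  have := NJ e x; rewrite !bre' linear0 !subr0 -!DE => /eqP.
  by rewrite subr_eq0 => /eqP.
have gDe x : g (D x) e = 0 by rewrite -gJ -DJ gDJe.
pose eta x y := g (br x y) e.
have brE x y : br x y = g x (J e) *: D y - g y (J e) *: D x + eta x y *: e.
  have brpr : br (pr x) (pr y) = br x y - (g x (J e) *: D y - g y (J e) *: D x).
    rewrite /pr Dl !Dr !Nl !Nr !Zl !Zr (lie_alternating L) !scaler0 !oppr0 addr0.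
    by rewrite (lie_anti L x (J e)) -!DE scalerN opprK opprB -addrA.
  have /vlineP[k kE] : br (pr x) (pr y) \in <[e]>%VS by rewrite -N1E brN.
  have -> : eta x y = k.
    have := congr1 (g^~ e) kE; rewrite brpr !(ipE ip) !gDe ee /eta => ?.
    by lra.
  by rewrite -kE brpr addrC subrK.
have gbrJe x y : g (br x y) (J e) = 0.
  by rewrite brE !(ipE ip) !gDJe gJ0 !mulr0 subr0 addr0.
have etaC x y : eta x y = - eta y x by rewrite /eta (lie_anti L) (ipNl ip).
have etae x : eta e x = 0 by rewrite /eta bre' (ip0l ip).
have etaX x : eta (J e) x = 0 by rewrite /eta -DE gDe.
have lin x : scalar (eta x) by move=> a y z; rewrite /eta Dr Zr !(ipE ip).
(* In the $e$-component of the Nijenhuis tensor the terms $J[\cdot,\cdot]$ drop out, because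
   brackets are orthogonal to $Je$. *)
have etaJ x y : eta (J x) (J y) = eta x y.
  have := congr1 (g^~ e) (NJ x y); rewrite !(ipE ip) !(gJl (br _ _)) !gbrJe /eta.
  by move=> ?; lra.
have etaD x y : eta (D x) y + eta x (D y) = 0.
  have := congr1 (g^~ e) (lie_jacobi L (J e) x y).
  rewrite !(ipE ip) -!DE gDe (lie_anti L y (J e)) -DE Nr (ipNl ip).
  by rewrite -/(eta x (D y)) -/(eta y (D x)) (etaC y) => ?; lra.
have D2 := SKT_affine_norm L S DJ ee De gDe gDJe (fun _ _ => erefl) etae etaJ etaD brE.
have [I [w wE]] := orthonormal_basis ip JJ gJ.
have Dg := skew_of_affine_norm ip wE D2.
have wedge := SKT_eta_wedge L S DJ ee (gJ0 e) gDe etae Dg (fun _ _ => erefl)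
  etaJ etaD brE.
have [x0 [y0 eta0]] : exists x y, eta x y != 0.
  apply: contrapT => no.
  have eta0 x y : eta x y = 0.
    by apply/eqP; apply: contrapT => /negP ?; apply: no; exists x, y.
  apply: brN0 => x y; rewrite !NE brE => /eqP -> /eqP ->.
  by rewrite eta0 !scale0r subrr addr0.
have [u [b [c [uu [ue uJe] Du c0 etaE]]]] :=
  decomposable_form ip JJ gJ DJ Dg lin etaC etae etaJ etaD wedge eta0.
exists D, e, u, b, c; split=> //; last by move=> x y; rewrite brE etaE.
(* With $D=0$ all brackets would be multiples of the central $e$. Then $\mathfrak g$ is nilpotent
   and contained in [N], against codimension one. *)
apply: contrapT => no.
have D0 x : D x = 0.
  by apply/eqP; apply: contrapT => /negP ?; apply: no; exists x.
have : (fullv <= N)%VS.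
  apply: maxN; first by move=> x y _; exact: memvf.
  exists 2; apply/eqP; rewrite -subv0; apply: lie_prod_subv => x y _ /=.
  have : (lie_prod br fullv fullv <= <[e]>)%VS.
    apply: lie_prod_subv => p q _ _.
    by rewrite brE !D0 !scaler0 subrr add0r rpredZ ?memv_line.
  by move=> /subvP sub /sub /vlineP[k ->]; rewrite Zr bre scaler0 mem0v.
by move=> /dimvS; rewrite -dN ltnn.
Qed.

(** * The model algebra *)

Definition row_of (R : realType) m (F : nat -> R) : 'rV[R]_m :=
  \row_(i < m) F i.+1.

Lemma fcovE (R : realType) m (x : 'rV[R]_m) (i : 'I_m) : fcov i.+1 x = x 0 i.
Proof. by rewrite /fcov (big_pred1 i). Qed.

Lemma fcov_row_of (R : realType) m (F : nat -> R) k :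
  (0 < k <= m)%N -> fcov k (row_of m F) = F k.
Proof.
by case: k => // k; rewrite andTb => km; rewrite (fcovE _ (Ordinal km)) mxE.
Qed.

Lemma fcov_is_scalar (R : realType) m k : scalar (@fcov R m k).
Proof.
move=> a x y; rewrite /fcov mulr_sumr -big_split /=.
by apply: eq_bigr => i _; rewrite !mxE.
Qed.

Lemma fcovD (R : realType) m k (x y : 'rV[R]_m) :
  fcov k (x + y) = fcov k x + fcov k y.
Proof. by have := fcov_is_scalar k 1 x y; rewrite scale1r mul1r. Qed.

Lemma fcov0 (R : realType) m k : fcov k (0 : 'rV[R]_m) = 0.
Proof. by rewrite /fcov big1 // => i _; rewrite mxE. Qed.

Lemma fcovZ (R : realType) m k a (x : 'rV[R]_m) : fcov k (a *: x) = a * fcov k x.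
Proof. by have := fcov_is_scalar k a x 0; rewrite fcov0 !addr0. Qed.

Lemma fcovN (R : realType) m k (x : 'rV[R]_m) : fcov k (- x) = - fcov k x.
Proof. by rewrite -scaleN1r fcovZ mulN1r. Qed.

Lemma fcov_fvec (R : realType) m k l :
  (0 < k <= m)%N -> fcov k (fvec R m l) = (k == l)%:R.
Proof. exact: (@fcov_row_of R m (fun k => (k == l)%:R) k). Qed.

Lemma fcov_inj (R : realType) m (x y : 'rV[R]_m) :
  (forall k, (0 < k <= m)%N -> fcov k x = fcov k y) -> x = y.
Proof.
by move=> xy; apply/rowP => i; rewrite -!fcovE xy //= ltn_ord.
Qed.

Lemma fcov_struct_bracket (R : realType) m
    (phi : nat -> 'rV[R]_m -> 'rV[R]_m -> R) x y k :
  (0 < k <= m)%N -> fcov k (struct_bracket phi x y) = - phi k x y.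
Proof. exact: (@fcov_row_of R m (fun k => - phi k x y) k). Qed.

Lemma std_inner_product (R : realType) m : inner_product (@std_metric R m).
Proof.
split=> [y a x x'|x y|x x0].
- rewrite /std_metric mulr_sumr -big_split /=; apply: eq_bigr => k _.
  by rewrite fcovD fcovZ; ring.
- by apply: eq_bigr => k _; rewrite mulrC.
have pos k : 0 <= fcov k x * fcov k x by rewrite -expr2 sqr_ge0.
rewrite lt_neqAle sumr_ge0 ?andbT => [|k _]; last exact: pos.
apply: contraNneq x0 => /esym; rewrite /std_metric big_add1 big_mkord => sum0.
apply/eqP/rowP => i; rewrite -fcovE mxE.
have /psumr_eq0P -/(_ (fun k _ => pos _)) h := sum0.
by have /eqP := h i isT; rewrite mulf_eq0 orbb => /eqP.
Qed.

Lemma std_metric_fvec (R : realType) m (x : 'rV[R]_m) k :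
  (0 < k <= m)%N -> std_metric x (fvec R m k) = fcov k x.
Proof.
case: k => // k km; rewrite /std_metric big_add1 big_mkord.
rewrite (bigD1 (Ordinal km)) //= fcov_fvec // eqxx mulr1 big1 ?addr0 // => i ik.
by rewrite fcov_fvec ?ltn_ord // eqSS (negbTE (ik : (i != k :> nat))) mulr0.
Qed.

(** Indices are grouped as the model complex structure pairs them: $\{1,2n\}$ and $\{2l,2l+1\}$. All
    computations in the model follow this grouping. *)
Lemma sum_J_pairs (M : nmodType) n (h : nat -> M) : (0 < n)%N ->
  \sum_(1 <= k < n.*2.+1) h k =
  h 1%N + h n.*2 + \sum_(1 <= l < n) (h l.*2 + h l.*2.+1).
Proof.
case: n => // n _; elim: n => [|n IHn].
  by rewrite big_nat_recl // big_nat1 [in RHS]big_geq ?addr0.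
rewrite [in RHS]big_nat_recr //= (doubleS n.+1) big_nat_recr // big_nat_recr // IHn.
by rewrite /= -!addrA; congr (_ + _); rewrite [RHS]addrC -!addrA [LHS]addrCA.
Qed.

Lemma J_pair_ind n (P : nat -> Prop) :
  P 1%N -> P n.*2 -> (forall l, (0 < l < n)%N -> P l.*2 /\ P l.*2.+1) ->
  forall k, (0 < k <= n.*2)%N -> P k.
Proof.
move=> P1 Pn Pl k /andP[k0 kn]; rewrite -(odd_double_half k) in k0 kn *.
case: (odd k) k0 kn => /=; rewrite ?add0n ?add1n.
  case: (k./2) => // l _; rewrite ltn_double => ln.
  by apply: (Pl l.+1 _).2.
rewrite double_gt0 leq_double (leq_eqVlt _ n) => k0 /orP[/eqP->//|kn].
by apply: (Pl _ _).1; rewrite k0.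
Qed.

(** Written on coordinates: $Jf_1=f_{2n}$ and $Jf_{2n}=-f_1$ put $-x_{2n}$ in slot $1$ and $x_1$ in
    slot $2n$. *)
Definition model_J (R : realType) n (x : 'rV[R]_(n.*2)) : 'rV[R]_(n.*2) :=
  row_of n.*2 (fun k => if k == 1%N then - fcov n.*2 x
    else if k == n.*2 then fcov 1 x
    else if odd k then fcov k.-1 x else - fcov k.+1 x).

(** The operator $\mathrm{ad}_{f_{2n}}$. *)
Definition model_D (R : realType) n (b : nat -> R) (x : 'rV[R]_(n.*2)) :
    'rV[R]_(n.*2) :=
  row_of n.*2 (fun k => if k == 1%N then 0 else if k == n.*2 then 0
    else if odd k then - b k./2 * fcov k.-1 x else b k./2 * fcov k.+1 x).

Lemma J_pair_bounds n l : (0 < l < n)%N ->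
  [/\ (0 < l.*2 <= n.*2)%N, (0 < l.*2.+1 <= n.*2)%N, (l.*2 == 1%N) = false,
      (l.*2 == n.*2) = false & (l.*2.+1 == 1%N) = false /\
      (l.*2.+1 == n.*2) = false].
Proof.
case: n l => [|n] [|l]; rewrite ?ltn0 ?andbF //= => ln.
by split=> //; last split=> //; lia.
Qed.

Lemma model_JE (R : realType) n (x : 'rV[R]_(n.*2)) : (0 < n)%N ->
  [/\ fcov 1 (model_J x) = - fcov n.*2 x, fcov n.*2 (model_J x) = fcov 1 x &
   forall l, (0 < l < n)%N -> fcov l.*2 (model_J x) = - fcov l.*2.+1 x /\
     fcov l.*2.+1 (model_J x) = fcov l.*2 x].
Proof.
move=> n0; have b1 : (0 < 1 <= n.*2)%N by lia.
have bn : (0 < n.*2 <= n.*2)%N by lia.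
rewrite !fcov_row_of //=.
split=> // [|l ln].
  by case: eqP => [n1|_]; [move: (congr1 odd n1); rewrite odd_double | rewrite eqxx].
have [be bo e1 e2 [e3 e4]] := J_pair_bounds ln.
by rewrite !fcov_row_of // e1 e2 e3 e4 /= odd_double.
Qed.

Lemma model_DE (R : realType) n b (x : 'rV[R]_(n.*2)) : (0 < n)%N ->
  [/\ fcov 1 (model_D b x) = 0, fcov n.*2 (model_D b x) = 0 &
   forall l, (0 < l < n)%N -> fcov l.*2 (model_D b x) = b l * fcov l.*2.+1 x /\
     fcov l.*2.+1 (model_D b x) = - b l * fcov l.*2 x].
Proof.
move=> n0; have b1 : (0 < 1 <= n.*2)%N by lia.
have bn : (0 < n.*2 <= n.*2)%N by lia.
rewrite !fcov_row_of //=.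
split=> // [|l ln]; first by rewrite eqxx if_same.
have [be bo e1 e2 [e3 e4]] := J_pair_bounds ln.
by rewrite !fcov_row_of // e1 e2 e3 e4 /= odd_double /= uphalf_double doubleK.
Qed.

Lemma model_bracketE (R : realType) n b (x y : 'rV[R]_(n.*2)) : (0 < n)%N ->
  [/\ fcov 1 (model_bracket b x y) = - fwedge 2 3 x y,
      fcov n.*2 (model_bracket b x y) = 0 &
   forall l, (0 < l < n)%N ->
     fcov l.*2 (model_bracket b x y) = - (b l * fwedge l.*2.+1 n.*2 x y) /\
     fcov l.*2.+1 (model_bracket b x y) = b l * fwedge l.*2 n.*2 x y].
Proof.
move=> n0; have b1 : (0 < 1 <= n.*2)%N by lia.
have bn : (0 < n.*2 <= n.*2)%N by lia.
rewrite !fcov_struct_bracket //=.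
rewrite /model_eqs; split=> // [|l ln].
  case: eqP => [n1|_]; first by move: (congr1 odd n1); rewrite odd_double.
  by rewrite eqxx oppr0.
have [be bo e1 e2 [e3 e4]] := J_pair_bounds ln.
rewrite !fcov_struct_bracket // /model_eqs e1 e2 e3 e4 /= odd_double /= uphalf_double doubleK.
by rewrite mulNr opprK.
Qed.

Lemma fcov_pair_inj (R : realType) n (x y : 'rV[R]_(n.*2)) :
    fcov 1 x = fcov 1 y -> fcov n.*2 x = fcov n.*2 y ->
    (forall l, (0 < l < n)%N ->
      fcov l.*2 x = fcov l.*2 y /\ fcov l.*2.+1 x = fcov l.*2.+1 y) ->
  x = y.
Proof.
move=> ? ? ?; apply: fcov_inj.
exact: (@J_pair_ind n (fun k => fcov k x = fcov k y)).
Qed.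

Lemma model_J_fvec (R : realType) n : (0 < n)%N ->
  model_J (fvec R n.*2 1) = fvec R n.*2 n.*2 /\
  forall l, (0 < l < n)%N ->
    model_J (fvec R n.*2 l.*2) = fvec R n.*2 l.*2.+1.
Proof.
move=> n0; have fv k l : (0 < k <= n.*2)%N ->
    fcov k (fvec R n.*2 l) = (k == l)%:R by exact: fcov_fvec.
have b1 : (0 < 1 <= n.*2)%N by lia.
have bn : (0 < n.*2 <= n.*2)%N by lia.
split=> [|l ln].
  have [J1 Jn JE] := @model_JE R n (fvec R n.*2 1) n0.
  apply: fcov_pair_inj => [||k kn].
  - rewrite J1 !fv //; have -> : (n.*2 == 1%N) = false by lia.
    have -> : (1%N == n.*2) = false by lia.
    by rewrite oppr0.
  - by rewrite Jn !fv // !eqxx.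
  have [be bo e1 e2 [e3 e4]] := J_pair_bounds kn; have [-> ->] := JE k kn.
  by rewrite !fv // e1 e2 e3 e4 oppr0.
have [J1 Jn JE] := @model_JE R n (fvec R n.*2 l.*2) n0.
apply: fcov_pair_inj => [||k kn].
- rewrite J1 !fv //; have -> : (n.*2 == l.*2) = false by lia.
  have -> : (1%N == l.*2.+1) = false by lia.
  by rewrite oppr0.
- rewrite Jn !fv //; have -> : (n.*2 == l.*2.+1) = false by lia.
  by have -> : (1%N == l.*2) = false by lia.
have [be bo _ _ _] := J_pair_bounds kn; have [-> ->] := JE k kn.
rewrite !fv //; have -> : (k.*2.+1 == l.*2) = false by lia.
have -> : (k.*2 == l.*2.+1) = false by lia.
by rewrite oppr0.
Qed.

(** The constants come from $[f_{2n},f_2]=-b_1f_3$ and $[f_2,f_3]=-f_1$. A nonzero $b_l$ forces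
    $n\geq2$, so $f_2,f_3$ do form a $J$-pair. *)
Lemma model_normal_form (R : realType) n (b : nat -> R) :
  not_all_vanishing n b ->
  exists J D : 'End('rV[R]_(n.*2)), J =1 @model_J R n /\
    normal_form (@model_bracket R n b) J (@std_metric R n.*2) D
      (fvec R n.*2 1) (fvec R n.*2 2) (- b 1%N) (-1).
Proof.
case=> l0 l0n bl0; have n0 : (0 < n)%N by lia.
have ln1 : (0 < 1 < n)%N by lia.
have JE x := @model_JE R n x n0; have DE x := @model_DE R n b x n0.
have J1 (x : 'rV[R]_(n.*2)) : fcov 1 (model_J x) = - fcov n.*2 x by have [] := JE x.
have Jn (x : 'rV[R]_(n.*2)) : fcov n.*2 (model_J x) = fcov 1 x by have [] := JE x.
have Je (x : 'rV[R]_(n.*2)) l : (0 < l < n)%N -> fcov l.*2 (model_J x) = - fcov l.*2.+1 x.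
  by have [_ _ H] := JE x; case/H.
have Jo (x : 'rV[R]_(n.*2)) l : (0 < l < n)%N -> fcov l.*2.+1 (model_J x) = fcov l.*2 x.
  by have [_ _ H] := JE x; case/H.
have D1 (x : 'rV[R]_(n.*2)) : fcov 1 (model_D b x) = 0 by have [] := DE x.
have Dn (x : 'rV[R]_(n.*2)) : fcov n.*2 (model_D b x) = 0 by have [] := DE x.
have De (x : 'rV[R]_(n.*2)) l : (0 < l < n)%N ->
    fcov l.*2 (model_D b x) = b l * fcov l.*2.+1 x.
  by have [_ _ H] := DE x; case/H.
have Do (x : 'rV[R]_(n.*2)) l : (0 < l < n)%N ->
    fcov l.*2.+1 (model_D b x) = - b l * fcov l.*2 x.
  by have [_ _ H] := DE x; case/H.
have [J JJ] : exists J : 'End('rV[R]_(n.*2)), J =1 @model_J R n.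
  apply: linear_hom => a x y.
  apply: fcov_pair_inj => [||l ln]; rewrite !(fcovD, fcovZ) ?(J1, Jn, Je, Jo) //;
    rewrite !(fcovD, fcovZ); try split; ring.
have [D DD] : exists D : 'End('rV[R]_(n.*2)), D =1 @model_D R n b.
  apply: linear_hom => a x y.
  apply: fcov_pair_inj => [||l ln]; rewrite !(fcovD, fcovZ) ?(D1, Dn, De, Do) //;
    rewrite ?(fcovD, fcovZ); try split; ring.
have metricE (x y : 'rV[R]_(n.*2)) : std_metric x y = fcov 1 x * fcov 1 y +
    fcov n.*2 x * fcov n.*2 y + \sum_(1 <= l < n)
      (fcov l.*2 x * fcov l.*2 y + fcov l.*2.+1 x * fcov l.*2.+1 y).
  exact: sum_J_pairs.
have b1 : (0 < 1 <= n.*2)%N by lia.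
have b2 : (0 < 2 <= n.*2)%N by lia.
have b3 : (0 < 3 <= n.*2)%N by lia.
have bn : (0 < n.*2 <= n.*2)%N by lia.
have fv k l : (0 < k <= n.*2)%N -> fcov k (fvec R n.*2 l) = (k == l)%:R.
  exact: fcov_fvec.
have fl l : (0 < l < n)%N -> [/\ fcov l.*2 (fvec R n.*2 1) = 0,
    fcov l.*2.+1 (fvec R n.*2 1) = 0, fcov l.*2 (fvec R n.*2 2) = (l == 1%N)%:R &
    fcov l.*2.+1 (fvec R n.*2 2) = 0].
  move=> ln; have [c1 c2 _ _ _] := J_pair_bounds ln.
  have -> : (l == 1%N) = (l.*2 == 2%N) by lia.
  rewrite !fv //; have [-> -> ->] : [/\ (l.*2 == 1%N) = false,
    (l.*2.+1 == 1%N) = false & (l.*2.+1 == 2%N) = false] by split; lia.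
  by [].
have [n1 n2 n3] : [/\ (n.*2 == 1%N) = false, (n.*2 == 2%N) = false &
  (n.*2 == 3%N) = false] by split; lia.
have [Jf1 Jf] := @model_J_fvec R n n0; have Jf2 := Jf 1%N ln1.
have metricf1 x := @std_metric_fvec R n.*2 x 1 b1.
have metricf2 x := @std_metric_fvec R n.*2 x 2 b2.
have metricf3 x := @std_metric_fvec R n.*2 x 3 b3.
have metricfn x := @std_metric_fvec R n.*2 x n.*2 bn.
exists J, D; split=> //.
split; rewrite ?JJ ?DD ?Jf1 ?Jf2 ?metricf1 ?metricf2 ?metricf3 ?metricfn ?fv //.
- exact: std_inner_product.
- move=> x; rewrite !JJ; apply: fcov_pair_inj => [||l ln]; rewrite !fcovN.
  + by rewrite J1 Jn.
  + by rewrite Jn J1.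
  + by rewrite Je // !Jo // Je.
- move=> x y; rewrite !JJ !metricE !J1 !Jn; congr (_ + _).
    by rewrite mulrNN addrC.
  by apply: eq_big_nat => l ln; rewrite !Je // !Jo // mulrNN addrC.
- move=> x; rewrite !JJ !DD; apply: fcov_pair_inj => [||l ln].
  + by rewrite D1 J1 Dn oppr0.
  + by rewrite Dn Jn D1.
  + rewrite De // Do // !Jo // !Je // Do // De //; split; ring.
- move=> x y; rewrite !DD !metricE !D1 !Dn !mul0r !mulr0 !add0r -sumrN.
  by apply: eq_big_nat => l ln; rewrite !De // !Do //; ring.
- apply: fcov_pair_inj => [||l ln]; rewrite ?D1 ?Dn ?fcov0 //.
  by rewrite De // Do //; have [-> -> _ _] := fl l ln; rewrite !mulr0.
- apply: fcov_pair_inj => [||l ln].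
  + by rewrite D1 fcovZ fv // mulr0.
  + by rewrite Dn fcovZ fv // n3 mulr0.
  have [be bo _ _ _] := J_pair_bounds ln; have [_ _ f1 f2] := fl l ln.
  rewrite De // Do // f1 f2 !fcovZ !fv //; have -> : (l.*2 == 3%N) = false by lia.
  have -> : (l.*2.+1 == 3%N) = (l == 1%N) by lia.
  by rewrite !mulr0; case: eqP => [->|_]; rewrite ?mulr0.
- by rewrite n2.
- by rewrite oppr_eq0 oner_eq0.
- exists (fvec R n.*2 l0.*2.+1); have [be bo _ _ _] := J_pair_bounds l0n.
  apply: contraNneq bl0 => /(congr1 (fcov l0.*2)).
  by rewrite DD De // fv // eqxx mulr1 fcov0 => ->.
move=> x y; have [B1 Bn B] := model_bracketE b x y n0.
rewrite !metricfn !metricf2 !metricf3 !DD.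
apply: fcov_pair_inj => [||l ln]; rewrite !(fcovD, fcovN, fcovZ).
- by rewrite B1 !D1 fv // eqxx mulr1n /fwedge; ring.
- by rewrite Bn !Dn fv // n1 mulr0n; ring.
have [be bo _ _ _] := J_pair_bounds ln; have [f1 f2 _ _] := fl l ln.
have [-> ->] := B l ln; rewrite !De // !Do // f1 f2 /fwedge; split; ring.
Qed.

(** * Isomorphism with the model *)

Lemma normal_form_pullback (R : realType) (V W : vectType R)
    (brV : V -> V -> V) (brW : W -> W -> W) (J : 'End(W)) (g : W -> W -> R)
    (D : 'End(W)) (e u : W) (b c : R) :
    lie_isomorphic brV brW -> normal_form brW J g D e u b c ->
  exists J' g' D' e' u', @normal_form R V brV J' g' D' e' u' b c.
Proof.
case=> f [f' fK f'K] fbr [ip JJ gJ DJ Dg De Du ee uu ue uJe c0 [x0 Dx0] brE].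
have conj_hom (h : 'End(W)) : exists h' : 'End(V), forall x, f (h' x) = h (f x).
  have [|h' h'E] := @linear_hom _ V V (fun x => f' (h (f x))).
    by move=> a x y; apply: (can_inj fK); rewrite f'K !linearP /= !f'K.
  by exists h' => x; rewrite h'E f'K.
have [J' J'E] := conj_hom J; have [D' D'E] := conj_hom D.
have f_inj := can_inj fK.
exists J', (fun x y => g (f x) (f y)), D', (f' e), (f' u); split.
- split=> [y a x x'|x y|x x1].
  + by rewrite linearP !(ipE ip).
  + exact: (ipC ip).
  + by apply: (ip_pos ip); rewrite -(linear0 f) (inj_eq f_inj).
- by move=> x; apply: f_inj; rewrite !J'E JJ linearN.
- by move=> x y; rewrite !J'E gJ.
- by move=> x; apply: f_inj; rewrite D'E !J'E DJ D'E.
- by move=> x y; rewrite !D'E.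
- by apply: f_inj; rewrite D'E f'K De linear0.
- by apply: f_inj; rewrite D'E f'K linearZ /= J'E f'K.
- by rewrite f'K.
- by rewrite f'K.
- by rewrite !f'K.
- by rewrite J'E !f'K.
- by [].
- exists (f' x0); apply: contra Dx0 => /eqP e0.
  by rewrite -[x0]f'K -D'E e0 linear0.
move=> x y; apply: f_inj; rewrite fbr brE !J'E !f'K.
by rewrite linearD linearB !linearZ /= !D'E f'K.
Qed.

Lemma bijective_dim (R : fieldType) (V W : vectType R) (f : {linear V -> W}) :
  bijective f -> \dim {:V} = \dim {:W}.
Proof.
case=> f' fK f'K; rewrite -(@limg_dim_eq _ _ _ (linfun f) {:V}).
  congr (\dim _); apply/vspaceP => y; rewrite memvf -[y]f'K -lfunE.
  by rewrite memv_img ?memvf.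
apply/eqP; rewrite -subv0; apply/subvP => x; rewrite memv_cap memv_ker lfunE.
by rewrite memv0 => /andP[_ /eqP fx]; rewrite -[x]fK fx -(linear0 f) fK.
Qed.

Lemma normal_form_isomorphic (R : realType) (V : vectType R) (br : V -> V -> V)
    (J : 'End(V)) (g : V -> V -> R) (D : 'End(V)) (e u : V) (b c : R) n :
    normal_form br J g D e u b c -> \dim {:V} = n.*2 ->
  exists2 b', not_all_vanishing n b' & lie_isomorphic br (@model_bracket R n b').
Proof.
move=> nf dV; have [gDe gDu gJ_ [eJe uJu] [eu eJu DJe]] := nf_eval nf.
case: nf => ip JJ gJ DJ Dg De Du ee uu ue uJe c0 [x0 Dx0] brE.
have gJl p q : g (J p) q = - g p (J q) by rewrite -gJ JJ (ipE ip).
have gJ0 p : g p (J p) = 0.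
  by have := gJl p p; rewrite (ipC ip) => ?; lra.
have DJu : D (J u) = - b *: u by rewrite DJ Du linearZ /= JJ scalerN scaleNr.
have [A1 A1E] := orth_vspace e ip; have [A2 A2E] := orth_vspace (J e) ip.
have [A3 A3E] := orth_vspace u ip; have [A4 A4E] := orth_vspace (J u) ip.
pose U := (A1 :&: A2 :&: (A3 :&: A4))%VS.
have UP x : reflect [/\ g x e = 0, g x (J e) = 0, g x u = 0 & g x (J u) = 0]
    (x \in U).
  rewrite !memv_cap A1E A2E A3E A4E.
  apply: (iffP andP) => [[/andP[/eqP ? /eqP ?] /andP[/eqP ? /eqP ?]] //|[]].
  by do 4!move/eqP=> ->.
have BE x : (D \o J)%VF x = D (J x) by rewrite comp_lfunE.
have [||||m [w [beta [wU Bw ww wJw wE]]]] :=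
    @unitary_eigenbasis R V g J (D \o J)%VF U ip JJ gJ.
- by move=> x y; rewrite !BE Dg gJl opprK DJ.
- by move=> x; rewrite !BE -!DJ.
- move=> x /UP[x1 x2 x3 x4]; apply/UP.
  by rewrite !gJ !gJl x1 x2 x3 x4 oppr0.
- move=> x /UP[x1 x2 x3 x4]; apply/UP.
  by rewrite !BE !(gDe _).1 !(gDe _).2 !(gDu _).1 !(gDu _).2 gJ gJl x3 x4 !oppr0 !mulr0.
have Dw i : (i < m)%N -> D (w i) = - beta i *: J (w i).
  move=> /Bw; rewrite BE DJ => /(congr1 J); rewrite JJ linearZ /= => /eqP.
  by rewrite eqr_oppLR -scaleNr => /eqP.
(* The model numbers its planes from 1 and reserves the first for $u$, hence the shift by two on
   [w]. *)
pose v l := if l == 1%N then u else w l.-2.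
pose d l := if l == 1%N then b else - beta l.-2.
have Dv l : (0 < l < m.+2)%N -> D (v l) = d l *: J (v l).
  rewrite /v /d; case: eqP => // l1 lm; rewrite Dw //; lia.
have vE l : (0 < l < m.+2)%N -> g (v l) e = 0 /\ g (v l) (J e) = 0.
  rewrite /v; case: eqP => // l1 lm.
  by have /wU/UP[] : (l.-2 < m)%N by lia.
have vv k l : (0 < k < m.+2)%N -> (0 < l < m.+2)%N ->
    g (v k) (v l) = (k == l)%:R /\ g (v k) (J (v l)) = 0.
  rewrite /v => km lm; case: (k =P 1%N) => k1; case: (l =P 1%N) => l1.
  - by rewrite k1 l1 uu uJu.
  - have /wU/UP[_ _ w1 w2] : (l.-2 < m)%N by lia.
    rewrite (ipC ip) w1 -[g u _]opprK -gJl (ipC ip) w2 oppr0.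
    by have -> : (k == l) = false by lia.
  - have /wU/UP[_ _ w1 w2] : (k.-2 < m)%N by lia.
    by have -> : (k == l) = false by lia.
  - rewrite ww ?wJw //; try lia.
    by have -> : (k.-2 == l.-2) = (k == l) by lia.
have xE x : x = g x e *: e + g x (J e) *: J e +
    \sum_(1 <= l < m.+2) (g x (v l) *: v l + g x (J (v l)) *: J (v l)).
  rewrite big_ltn // big_add1 /= big_add1 /= big_mkord /v /=.
  rewrite addrA; set y := _ + _ + (g x u *: u + g x (J u) *: J u).
  have gyE z : g z e = 0 /\ g z (J e) = 0 -> g z u = 0 /\ g z (J u) = 0 ->
      g y z = 0.
    move=> [z1 z2] [z3 z4]; rewrite (ipC ip) /y !(ipE ip) z1 z2 z3 z4.
    by rewrite !mulr0 !addr0.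
  have gJuu : g (J u) u = 0 by rewrite gJl uJu oppr0.
  have xyU : x - y \in U.
    apply/UP; rewrite /y !(ipE ip) !gJ !(gJl e) !(gJl u) ee uu ue uJe eJe uJu eu eJu.
    by split; ring.
  apply/eqP; rewrite addrC -subr_eq [X in X == _](wE _ xyU); apply/eqP.
  apply: eq_bigr => i _; have /UP[w1 w2 w3 w4] := wU _ (ltn_ord i).
  rewrite !(ipBl ip) !gyE ?subr0 //.
  - by rewrite !gJ !gJl w1 w2 oppr0.
  - by rewrite !gJ !gJl w3 w4 oppr0.
pose p := m.+2.
(* The factor $-c^{-1}$ makes $f_1$ correspond to $-ce$, so that $[u,Ju]=ce$ becomes
   $[f_2,f_3]=-f_1$. *)
pose F x : 'rV[R]_(p.*2) := row_of p.*2 (fun k =>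
  if k == 1%N then - (c^-1 * g x e) else if k == p.*2 then g x (J e)
  else if odd k then g x (J (v k./2)) else g x (v k./2)).
have F1 x : fcov 1 (F x) = - (c^-1 * g x e) by rewrite fcov_row_of.
have Fp x : fcov p.*2 (F x) = g x (J e) by rewrite fcov_row_of ?leqnn //= eqxx.
have Fl l : (0 < l < p)%N ->
    forall x, fcov l.*2 (F x) = g x (v l) /\ fcov l.*2.+1 (F x) = g x (J (v l)).
  move=> lp x; have [be bo e1 e2 [e3 e4]] := J_pair_bounds lp.
  by rewrite !fcov_row_of // e1 e2 e3 e4 /= odd_double /= uphalf_double doubleK.
have F_linear : linear F.
  move=> a x y; apply: fcov_pair_inj => [||l lp]; rewrite !(fcovD, fcovZ).
  - by rewrite !F1 !(ipE ip); ring.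
  - by rewrite !Fp !(ipE ip).
  have [Fx1 Fx2] := Fl l lp x; have [Fy1 Fy2] := Fl l lp y.
  by have [-> ->] := Fl l lp (a *: x + y); rewrite Fx1 Fx2 Fy1 Fy2 !(ipE ip).
pose f : {linear V -> 'rV[R]_(p.*2)} :=
  HB.pack F (GRing.isLinear.Build R V 'rV[R]_(p.*2) _ F F_linear).
pose G (y : 'rV[R]_(p.*2)) := - (c * fcov 1 y) *: e + fcov p.*2 y *: J e +
  \sum_(1 <= l < p) (fcov l.*2 y *: v l + fcov l.*2.+1 y *: J (v l)).
have FK : cancel F G.
  move=> x; rewrite /G F1 Fp [RHS]xE; congr (_ *: _ + _ + _).
    by rewrite mulrN opprK mulrA mulfV // mul1r.
  by apply: eq_big_nat => l lp; have [-> ->] := Fl l lp x.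
have delta_sum k (h : nat -> R) : (0 < k < p)%N ->
    \sum_(1 <= l < p) h l * (l == k)%:R = h k.
  move=> kp; rewrite (bigD1_seq k) ?mem_index_iota ?iota_uniq //= eqxx mulr1.
  by rewrite big1 ?addr0 // => l /negbTE ->; rewrite mulr0.
have GK : cancel G F.
  move=> y; have gG z : g (G y) z = - (c * fcov 1 y) * g e z +
      fcov p.*2 y * g (J e) z + \sum_(1 <= l < p)
        (fcov l.*2 y * g (v l) z + fcov l.*2.+1 y * g (J (v l)) z).
    rewrite /G !(ipE ip) (ip_suml ip); congr (_ + _); apply: eq_bigr => l _.
    by rewrite !(ipE ip).
  apply: fcov_pair_inj => [||k kp].
  - rewrite F1 gG ee gJl eJe big_nat big1 => [|l lp]; first by field.
    by have [-> v2] := vE l lp; rewrite gJl v2 oppr0 !mulr0 addr0.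
  - rewrite Fp gG eJe gJ ee big_nat big1 => [|l lp]; first by ring.
    by have [v1 ->] := vE l lp; rewrite gJ v1 !mulr0 addr0.
  have [-> ->] := Fl k kp (G y); have [v1 v2] := vE k kp.
  have e1 : g e (v k) = 0 by rewrite (ipC ip).
  have e2 : g (J e) (v k) = 0 by rewrite (ipC ip).
  have e3 : g e (J (v k)) = 0 by apply/eqP; rewrite -oppr_eq0 -gJl e2.
  rewrite !gG gJ e1 e2 e3 !mulr0 !add0r; split.
    rewrite -[RHS](delta_sum k (fun l => fcov l.*2 y)) //.
    apply: eq_big_nat => l lp; have [vv1 vv2] := vv l k lp kp.
    by rewrite gJl vv1 vv2 oppr0 mulr0 addr0.
  rewrite -[RHS](delta_sum k (fun l => fcov l.*2.+1 y)) //.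
  apply: eq_big_nat => l lp; have [vv1 vv2] := vv l k lp kp.
  by rewrite gJ vv1 vv2 mulr0 add0r.
have f_bij : bijective f by exists G.
(* The number of planes produced by the diagonalization is identified only here, by comparing
   dimensions. *)
have np : n = p.
  apply: double_inj; rewrite -dV (bijective_dim f_bij) dimvf.
  by rewrite /dim /= mul1n.
move: dV; rewrite np => _.
(* The sign reflects $Dv_l=d_lJv_l$ against $[f_{2n},f_{2l}]=-b_lf_{2l+1}$. *)
exists (fun l => - d l).
  apply: contrapT => no; case/eqP: Dx0.
  have d0 l : (0 < l < p)%N -> d l = 0.
    move=> lp; apply/eqP; apply: contrapT => /negP dl; apply: no; exists l => //.
    by rewrite oppr_eq0.
  have DZ k y : D (k *: y) = k *: D y by rewrite linearZ.
  rewrite (xE x0) !linearD /= !DZ De DJe !scaler0 !add0r linear_sum.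
  rewrite big_nat big1 // => l lp; rewrite linearD /= !DZ DJ Dv // d0 //.
  by rewrite scale0r !linear0 addr0.
exists f => // x y; have p0 : (0 < p)%N by [].
have [M1 Mp M] := model_bracketE (fun l => - d l) (F x) (F y) p0.
have F23 z : fcov 2 (F z) = g z u /\ fcov 3 (F z) = g z (J u).
  exact: (Fl 1%N).
apply: fcov_pair_inj => [||l lp].
- rewrite M1 [fcov 1 _]F1 /fwedge !(F23 _).1 !(F23 _).2 brE !(ipE ip) !(gDe _).1 ee.
  by field.
- by rewrite Mp [LHS]Fp brE !(ipE ip) !(gDe _).2 eJe; ring.
have [-> ->] := M l lp; have [v1 v2] := vE l lp.
have [Fx1 Fx2] := Fl l lp x; have [Fy1 Fy2] := Fl l lp y.
rewrite /fwedge Fx1 Fx2 Fy1 Fy2 !Fp; have [-> ->] := Fl l lp (br x y).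
have e1 : g e (v l) = 0 by rewrite (ipC ip).
have e2 : g e (J (v l)) = 0.
  by apply/eqP; rewrite -oppr_eq0 -gJl (ipC ip) v2.
rewrite brE !(ipE ip) !Dg DJ Dv // linearZ /= JJ !(ipE ip) e1 e2.
by split; ring.
Qed.

(** * Diagonal rescalings and dimension six *)

Lemma lie_isomorphic_trans (R : fieldType) (U V W : vectType R)
    (brU : U -> U -> U) (brV : V -> V -> V) (brW : W -> W -> W) :
  lie_isomorphic brU brV -> lie_isomorphic brV brW -> lie_isomorphic brU brW.
Proof.
move=> [f bf fbr] [h bh hbr]; exists (h \o f); first exact: bij_comp.
by move=> x y /=; rewrite fbr hbr.
Qed.

Definition rescale (R : realType) m (s : nat -> R) (x : 'rV[R]_m) : 'rV[R]_m :=
  row_of m (fun k => s k * fcov k x).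

Lemma rescale_isomorphic (R : realType) m (s : nat -> R)
    (phi psi : nat -> 'rV[R]_m -> 'rV[R]_m -> R) :
    (forall k, s k != 0) ->
    (forall x y k, (0 < k <= m)%N ->
      s k * phi k x y = psi k (rescale s x) (rescale s y)) ->
  lie_isomorphic (struct_bracket phi) (struct_bracket psi).
Proof.
move=> s0 phi_psi.
have rescale_linear : linear (@rescale R m s).
  move=> a x y; apply: fcov_inj => k km.
  by rewrite fcovD fcovZ !fcov_row_of // fcovD fcovZ; ring.
pose f : {linear 'rV[R]_m -> 'rV[R]_m} := HB.pack (@rescale R m s)
  (GRing.isLinear.Build R 'rV[R]_m 'rV[R]_m _ (@rescale R m s) rescale_linear).
exists f => [|x y].
  exists (rescale (fun k => (s k)^-1)) => x; apply: fcov_inj => k km;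
    rewrite !fcov_row_of //; first by rewrite mulKf.
  by rewrite mulVKf.
apply: fcov_inj => k km.
by rewrite fcov_struct_bracket // fcov_row_of // fcov_struct_bracket // mulrN phi_psi.
Qed.

(** Rescaling $f^6$ absorbs one nonzero $b_l$. The three cases are $b_1=0$, $b_2=0$, and both
    nonzero; in the last only $|b_2/b_1|$ survives. *)
Lemma model6_isomorphic (R : realType) (b : nat -> R) :
  not_all_vanishing 3 b ->
  [\/ lie_isomorphic (@model_bracket R 3 b) (@h3_s33 R),
      lie_isomorphic (@model_bracket R 3 b) (@s47_R2 R)
    | exists2 b', 0 < b' & lie_isomorphic (@model_bracket R 3 b) (@s652 R b')].
Proof.
move=> nb; have [b1|b1] := eqVneq (b 1%N) 0.
  have b2 : b 2%N != 0.
    by case: nb => [[|[|[|l]]]] //=; rewrite b1 eqxx.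
  apply: Or31; apply: (@rescale_isomorphic R 6 (fun k => if k == 6 then b 2%N else 1)).
    by move=> k; case: ifP => // _; rewrite oner_eq0.
  move=> x y [|[|[|[|[|[|[|k]]]]]]] // _;
    rewrite /model_eqs /fwedge /rescale /= ?fcov_row_of //= ?b1; ring.
have [b2|b2] := eqVneq (b 2%N) 0.
  apply: Or32; apply: (@rescale_isomorphic R 6 (fun k => if k == 6 then b 1%N else 1)).
    by move=> k; case: ifP => // _; rewrite oner_eq0.
  move=> x y [|[|[|[|[|[|[|k]]]]]]] // _;
    rewrite /model_eqs /fwedge /rescale /= ?fcov_row_of //= ?b2; ring.
pose t := b 2%N / b 1%N; have t0 : t != 0 by rewrite mulf_neq0 ?invr_eq0.
have bt : b 2%N = t * b 1%N by rewrite divfK.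
apply: Or33; exists `|t|; first by rewrite normr_gt0.
(* Changing the sign of [f_5] changes that of [b_2]. *)
apply: (@rescale_isomorphic R 6 (fun k =>
  if k == 6 then b 1%N else if k == 5 then Num.sg t else 1)).
  move=> k; case: ifP => // _; case: ifP => _; rewrite ?sgr_eq0 ?oner_eq0 //.
have sgt : Num.sg t * Num.sg t = 1 by rewrite -expr2 sqr_sg t0.
move=> x y [|[|[|[|[|[|[|k]]]]]]] // _;
  rewrite /model_eqs /fwedge /rescale /= ?fcov_row_of //= ?bt ?normrEsg;
  try ring; ring: sgt.
Qed.

Theorem theorem4p4 (R : realType) (n : nat) :
  (forall (V : vectType R) (br : V -> V -> V) (N : {vspace V}),
     lie_bracket br ->
     \dim {:V} = n.*2 ->
     is_nilradical br N ->
     almost_nilpotent br N ->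
     strongly_unimodular br N ->
     \dim (lower_central br N 1) = 1%N ->
     let admits_SKT :=
       exists (J : 'End(V)) (g : V -> V -> R),
         SKT br J g /\ J_derived_eq_orth br N J g in
     [/\ admits_SKT <->
           (exists2 b : nat -> R,
              not_all_vanishing n b &
              lie_isomorphic br (@model_bracket R n b)),
         admits_SKT -> type_I br
       & n = 3%N -> admits_SKT ->
           [\/ lie_isomorphic br (@h3_s33 R),
               lie_isomorphic br (@s47_R2 R)
             | exists2 b : R, 0 < b & lie_isomorphic br (@s652 R b)]])
  /\
  (forall b : nat -> R, not_all_vanishing n b ->
     lie_bracket (@model_bracket R n b) /\
     exists (N : {vspace 'rV[R]_(n.*2)}) (J : 'End('rV[R]_(n.*2))),
       [/\ is_nilradical (@model_bracket R n b) N,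
           J (fvec R n.*2 1) = fvec R n.*2 n.*2,
           forall l, (1 <= l < n)%N ->
             J (fvec R n.*2 l.*2) = fvec R n.*2 l.*2.+1,
           SKT (@model_bracket R n b) J (@std_metric R n.*2)
         & J_derived_eq_orth (@model_bracket R n b) N J (@std_metric R n.*2)]).
Proof.
split=> [V br N L dV nilN aN SU dN1 admits_SKT | b nb].
  have to_model : admits_SKT -> exists2 b : nat -> R, not_all_vanishing n b &
      lie_isomorphic br (@model_bracket R n b).
    move=> [J [g [S JN]]].
    have [D [e [u [b [c nf]]]]] := SKT_normal_form L nilN aN SU dN1 S JN.
    exact: normal_form_isomorphic nf dV.
  split.
  - split=> // -[b nb iso]; have [J [D [_ nfW]]] := model_normal_form nb.
    have [J' [g' [D' [e' [u' nf]]]]] := normal_form_pullback iso nfW.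
    exists J', g'; split; first exact: nf_SKT nf.
    (* The nilradical is not carried along the isomorphism: the normal form shows that
       $(J'e')^\perp$ is one, and uniqueness identifies it with [N]. *)
    have [K KE] := orth_vspace (J' e') (nf_ip nf).
    have [nilK _ JK] := nf_nilradical nf KE.
    by rewrite -(nilradical_unique nilK nilN).
  - move=> [J [g [S JN]]].
    have [D [e [u [b [c nf]]]]] := SKT_normal_form L nilN aN SU dN1 S JN.
    exact: nf_type_I nf.
  - move=> n3 /to_model[]; rewrite n3 => b nb iso.
    case: (model6_isomorphic nb) => [iso6|iso6|[b' b'0 iso6]].
    + by apply: Or31; exact: lie_isomorphic_trans iso iso6.
    + by apply: Or32; exact: lie_isomorphic_trans iso iso6.
    + by apply: Or33; exists b' => //; exact: lie_isomorphic_trans iso iso6.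
have [J [D [JE nf]]] := model_normal_form nb.
split; first exact: nf_lie_bracket nf.
have [K KE] := orth_vspace (J (fvec R n.*2 1)) (nf_ip nf).
have [nilK _ JK] := nf_nilradical nf KE.
have n0 : (0 < n)%N by case: nb => l /andP[_ ln] _; exact: leq_ltn_trans ln.
have [J1 Jl] := @model_J_fvec R n n0.
exists K, J; split=> //; first by rewrite JE J1.
  by move=> l ln; rewrite JE Jl.
exact: nf_SKT nf.
Qed.
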